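(* Let $X$ be a smooth connected variety over $\mathbb{C}$ with $H^0(X,\mathcal{O}_X^* )=\mathbb{C}^*$, and let $g_1\in H^1(X,\mathcal{O}_X^* )=\mathrm{Pic}(X)$ be the class of a line bundle $L$. Consider the exact sequence of sheaves of groups $0\to T_X\to\mathcal{G}_2\xrightarrow{\ \xi_2\ }\mathcal{O}_X^*\to 0$ and the twisted sheaf $T_X^{g_1}$. Then: 1. $T_X^{g_1}\simeq T_X\otimes L$. 2. The action of $H^0(X,\mathcal{O}_X^* )=\mathbb{C}^*$ on $H^1(X,T_X^{g_1})=H^1(X,T_X\otimes L)$ is the multiplication.
   Context: For an open $U\subset X$, $\mathcal{G}_2(U)$ is the group of automorphisms of the $\mathbb{C}$-algebra $\mathcal{O}_X(U)[t]/(t^2)$ inducing the identity on its quotient $\mathcal{O}_X(U)$ by $(t)$. Such an automorphism is of the form $f\mapsto f+D(f)t$ for $f\in\mathcal{O}_X(U)$, $t\mapsto\alpha t$, with $D$ a derivation of $\mathcal{O}_X(U)$ and $\alpha\in\mathcal{O}_X(U)^*$; $\xi_2$ sends it to $\alpha$, and $\ker(\xi_2)\simeq T_X$ (the automorphisms with $\alpha=1$). The sheaf $\mathcal{G}_2$ acts by conjugation on its commutative normal subgroup sheaf $T_X$, and this action factors through $\mathcal{O}_X^*$. If $g_1$ is represented by a cocycle $(\alpha_{ij})$ for an open cover $(U_i)$, $T_X^{g_1}$ is the sheaf obtained by gluing the sheaves $T_{X|U_i}$ by means of the automorphisms of $T_{X|U_{ij}}$ given by the action of $\alpha_{ij}$: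 its sections are families $(\gamma_i)$, $\gamma_i\in T_X(U_i)$, with $\gamma_i=\alpha_{ij}\cdot\gamma_j$ on $U_{ij}$. Let $g_{ij}\in\mathcal{G}_2(U_{ij})$ be the automorphism $f\mapsto f$, $t\mapsto\alpha_{ij}t$ (the cocycle $(g_{ij})$ defines the trivial primitive double scheme with associated line bundle $L$, i.e. the second infinitesimal neighbourhood of the zero section in $L^*$). The action of $h\in H^0(X,\mathcal{O}_X^* )$ on $H^1(X,T_X^{g_1})$ is defined as follows: lift $h_{|U_i}$ to $h_i\in\mathcal{G}_2(U_i)$; if $\gamma\in H^1(X,T_X^{g_1})$ is represented by $(\gamma_{ij})$, $\gamma_{ij}\in T_X(U_{ij})\subset\mathcal{G}_2(U_{ij})$, then $h\cdot\gamma$ is represented by $(h_i\gamma_{ij}g_{ij}h_j^{-1}g_{ij}^{-1})$. The orbits of this action are the fibres of the surjective map $\gamma\mapsto[(\gamma_{ij}g_{ij})]$ from $H^1(X,T_X^{g_1})$ onto the set of classes in $H^1(X,\mathcal{G}_2)$ with image $g_1$. *)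

(* Defs.v *)
From HB Require Import structures.
From mathcomp Require Import all_boot all_order all_algebra.
From mathcomp Require Import complex.
From mathcomp Require Import boolp classical_sets functions reals topology.
From mathcomp Require mpoly.

Set Implicit Arguments.
Unset Strict Implicit.
Unset Printing Implicit Defensive.

Import GRing.Theory.
Local Open Scope classical_set_scope.
Local Open Scope complex_scope.
Local Open Scope ring_scope.
Local Open Scope quotient_scope.

Record openset (X : topologicalType) := OpenSet {
  oset :> set X;
  open_oset : open oset
}.

Definition omem {X : topologicalType} (U : openset X) (x : X) : Prop :=
  oset U x.
Coercion omem : openset >-> Funclass.

Definition oT {X : topologicalType} : openset X := OpenSet (@openT X).

Definition oI {X : topologicalType} (U V : openset X) : openset X :=
  OpenSet (openI (open_oset U) (open_oset V)).

Lemma oT_sub {X : topologicalType} (U : openset X) : U `<=` oT.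
Proof. exact: subsetT. Qed.

Lemma oI_l {X : topologicalType} (U V : openset X) : oI U V `<=` U.
Proof. by move=> x []. Qed.

Lemma oI_r {X : topologicalType} (U V : openset X) : oI U V `<=` V.
Proof. by move=> x []. Qed.

Lemma oIS {X : topologicalType} (U U' V V' : openset X) :
  U `<=` U' -> V `<=` V' -> oI U V `<=` oI U' V'.
Proof. exact: setISS. Qed.

Lemma oI_sub {X : topologicalType} (U V W : openset X) :
  W `<=` U -> W `<=` V -> W `<=` oI U V.
Proof. by move=> WU WV x Wx; split; [exact: WU|exact: WV]. Qed.

Definition pts {X : Type} (U : set X) := {x : X | U x}.

Definition incl {X : Type} {V U : set X} (H : V `<=` U) (x : pts V) : pts U :=
  exist _ (sval x) (H _ (proj2_sig x)).

(* Varieties are taken in the sense of Serre's FAC: a space equipped with a   *)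
(* sheaf of C-valued functions.                                               *)
Record fspace (R : realType) := FSpace {
  fspace_car :> topologicalType;
  regular : forall U : openset fspace_car, (pts U -> R[i]) -> Prop;
  regular_cst : forall U (c : R[i]), @regular U (fun _ => c);
  regularB : forall (U : openset fspace_car) (f g : pts U -> R[i]),
    regular f -> regular g -> regular (f - g);
  regularM : forall (U : openset fspace_car) (f g : pts U -> R[i]),
    regular f -> regular g -> regular (f * g);
  regular_res : forall (U V : openset fspace_car) (H : V `<=` U)
    (f : pts U -> R[i]), regular f -> @regular V (f \o incl H);
  regular_glue : forall (U : openset fspace_car) (f : pts U -> R[i]),
    (forall x : pts U, exists (V : openset fspace_car) (H : V `<=` U),
       V (sval x) /\ @regular V (f \o incl H)) ->
    regular f
}.

Section Variety.
Variables (R : realType) (X : fspace R).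
Local Notation C := R[i].

Local Notation "p .@[ v ]" := (mpoly.meval v p).

(* [e] identifies W with the Zariski-closed set V(S) of C^n: as a point set,  *)
(* as a topological space (a subset of V(S) is open iff it is a union of      *)
(* principal open sets) and as a space with functions (a function is regular  *)
(* iff it is locally a quotient of polynomials).                              *)
Record affine_chart (W : openset X) (n : nat) (e : X -> 'I_n -> C)
    (S : set (mpoly.mpoly n C)) : Prop := AffineChart {
  chart_inj : forall x y, W x -> W y -> e x = e y -> x = y;
  chart_img : e @` W = [set v | forall p, S p -> p.@[v] = 0];
  chart_open : forall A : set X, A `<=` W ->
    open A <-> forall x, A x -> exists h : mpoly.mpoly n C,
      h.@[e x] != 0 /\ forall y, W y -> h.@[e y] != 0 -> A y;
  chart_regular : forall (V : openset X), V `<=` W ->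
    forall f : pts V -> C, regular f <->
      forall x : pts V, exists g h : mpoly.mpoly n C,
        h.@[e (sval x)] != 0 /\
        forall y : pts V, h.@[e (sval y)] != 0 ->
          f y = g.@[e (sval y)] / h.@[e (sval y)]
}.

Definition join_coords n m (u : 'I_n -> C) (v : 'I_m -> C) (k : 'I_(n + m)) :=
  match fintype.split k with inl i => u i | inr j => v j end.

(* The diagonal is closed in X x X; the product carries the Zariski topology  *)
(* given by the products of affine charts.                                    *)
Definition separated : Prop :=
  forall (W : openset X) n (e : X -> 'I_n -> C) S
         (W' : openset X) n' (e' : X -> 'I_n' -> C) S',
    affine_chart W e S -> affine_chart W' e' S' ->
    exists Q : set (mpoly.mpoly (n + n') C),
      forall x y, W x -> W' y ->
        x = y <-> forall q, Q q -> q.@[join_coords (e x) (e' y)] = 0.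

Definition finite_affine_cover : Prop :=
  exists (m : nat) (W : 'I_m -> openset X),
    (forall x, exists i, W i x) /\
    (forall i, exists n (e : X -> 'I_n -> C) S, affine_chart (W i) e S).

(* Smoothness over C by the Jacobian criterion, in the standard smooth form:  *)
(* locally X is V(f_1, ..., f_r) in C^n with Jacobian matrix of rank r at     *)
(* each point (which forces the ideal (f_1, ..., f_r) to be radical).         *)
Definition smooth : Prop :=
  forall x : X, exists (W : openset X) n (e : X -> 'I_n -> C) r
      (f : 'I_r -> mpoly.mpoly n C),
    [/\ W x, affine_chart W e (range f) &
        forall y, W y ->
          \rank (\matrix_(i < r, j < n) (mpoly.mderiv j (f i)).@[e y]) = r].

Definition smooth_connected_variety : Prop :=
  [/\ finite_affine_cover, separated, smooth,
      [set: X] !=set0 & connected [set: X]].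

End Variety.

Section StructureSheaf.
Variables (R : realType) (X : fspace R).
Local Notation C := R[i].

Definition is_regular (U : openset X) : {pred pts U -> C} :=
  fun f => `[< regular f >].

Lemma is_regular_subring U : subring_closed (@is_regular U).
Proof.
split.
- by apply/asboolP; exact: regular_cst.
- by move=> f g /asboolP rf /asboolP rg; apply/asboolP; exact: regularB.
- by move=> f g /asboolP rf /asboolP rg; apply/asboolP; exact: regularM.
Qed.

(* The ring O_X(U); it is the zero ring when U is empty. *)
Record O (U : openset X) := RegFun {
  rfun :> pts U -> C;
  rfun_regular : is_regular rfun
}.

HB.instance Definition _ (U : openset X) := [isSub of O U for @rfun U].
HB.instance Definition _ (U : openset X) := [Choice of O U by <:].
HB.instance Definition _ (U : openset X) :=
  GRing.SubChoice_isSubComPzRing.Build (pts U -> C) (@is_regular U) (O U)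
    (@is_regular_subring U).

Definition ocst (U : openset X) (c : C) : O U :=
  RegFun (asboolT (regular_cst U c)).

Definition ores (U V : openset X) (H : V `<=` U) (f : O U) : O V :=
  RegFun (asboolT (regular_res H (asboolW (rfun_regular f)))).

Lemma oresD (U V : openset X) (H : V `<=` U) : {morph ores H : f g / f + g}.
Proof. by move=> f g; apply: val_inj. Qed.

Lemma oresM (U V : openset X) (H : V `<=` U) : {morph ores H : f g / f * g}.
Proof. by move=> f g; apply: val_inj. Qed.

Lemma oresN (U V : openset X) (H : V `<=` U) : {morph ores H : f / - f}.
Proof. by move=> f; apply: val_inj. Qed.

Lemma ores0 (U V : openset X) (H : V `<=` U) : ores H 0 = 0.
Proof. exact: val_inj. Qed.

Lemma ores1 (U V : openset X) (H : V `<=` U) : ores H 1 = 1.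
Proof. exact: val_inj. Qed.

Lemma ores_comp (U V W : openset X) (HVU : V `<=` U) (HWV : W `<=` V)
  (HWU : W `<=` U) (f : O U) : ores HWV (ores HVU f) = ores HWU f.
Proof.
apply: val_inj; apply: funext => x /=; congr (rfun f _).
by rewrite /incl; congr exist; exact: Prop_irrelevance.
Qed.

Lemma ores_id (U : openset X) (H : U `<=` U) (f : O U) : ores H f = f.
Proof.
apply: val_inj; apply: funext => -[x Ux] /=; congr (rfun f _).
by rewrite /incl; congr exist; exact: Prop_irrelevance.
Qed.

Lemma ores_cst (U V : openset X) (H : V `<=` U) c :
  ores H (ocst U c) = ocst V c.
Proof. exact: val_inj. Qed.

End StructureSheaf.

Section Modules.
Variables (R : realType) (X : fspace R).

(* Presheaves of O_X-modules; [is_sheaf] is the sheaf condition. *)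
Record omodule := OModule {
  msec :> forall U : openset X, lmodType (O U);
  mres : forall U V : openset X, V `<=` U -> msec U -> msec V;
  mresD : forall (U V : openset X) (H : V `<=` U), {morph mres H : s t / s + t};
  mresZ : forall (U V : openset X) (H : V `<=` U) (a : O U) (s : msec U),
    mres H (a *: s) = ores H a *: mres H s;
  mres_id : forall (U : openset X) (H : U `<=` U) (s : msec U), mres H s = s;
  mres_comp : forall (U V W : openset X) (HVU : V `<=` U) (HWV : W `<=` V)
    (HWU : W `<=` U) (s : msec U), mres HWV (mres HVU s) = mres HWU s
}.

Definition is_sheaf (M : omodule) : Prop :=
  forall (U : openset X) (I : Type) (V : I -> openset X)
    (HV : forall i, V i `<=` U), (forall x, U x -> exists i, V i x) ->
  forall s : forall i, M (V i),
    (forall i j (W : openset X) (Wi : W `<=` V i) (Wj : W `<=` V j),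
       mres Wi (s i) = mres Wj (s j)) ->
  exists! t : M U, forall i, mres (HV i) t = s i.

Record omod_hom (M N : omodule) := OModHom {
  hmap :> forall U : openset X, {linear M U -> N U};
  hmap_res : forall (U V : openset X) (H : V `<=` U) (s : M U),
    hmap V (mres H s) = mres H (hmap U s)
}.

Definition omod_iso (M N : omodule) (phi : omod_hom M N) : Prop :=
  forall U, bijective (phi U).

End Modules.

Section ModuleTheory.
Variables (R : realType) (X : fspace R) (M : omodule X).
Variables (U V : openset X) (H : V `<=` U).

Lemma mres0 : mres H (0 : M U) = 0.
Proof. by apply: (addIr (mres H (0 : M U))); rewrite -mresD !add0r. Qed.

Lemma mresN (s : M U) : mres H (- s) = - mres H s.
Proof. by apply/eqP; rewrite -addr_eq0 -mresD addNr mres0. Qed.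

End ModuleTheory.

#[local] Obligation Tactic := idtac.

Section Derivations.
Variables (R : realType) (X : fspace R).
Local Notation C := R[i].

(* C-derivations of the sheaf O_U, i.e. families of C-derivations of the      *)
(* O_X(V), V contained in U, compatible with restrictions.  For U affine      *)
(* these are the C-derivations of O_X(U).                                     *)
Record der (U : openset X) := Der {
  dfun : forall V : openset X, V `<=` U -> O V -> O V;
  dfunD : forall (V : openset X) (H : V `<=` U), {morph dfun H : f g / f + g};
  dfunM : forall (V : openset X) (H : V `<=` U) (f g : O V),
    dfun H (f * g) = f * dfun H g + g * dfun H f;
  dfun_cst : forall (V : openset X) (H : V `<=` U) (c : C),
    dfun H (ocst V c) = 0;
  dfun_res : forall (V W : openset X) (HV : V `<=` U) (HW : W `<=` U)
    (HWV : W `<=` V) (f : O V), ores HWV (dfun HV f) = dfun HW (ores HWV f)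
}.

Lemma der_ext U (D E : der U) :
  (forall (V : openset X) (H : V `<=` U) f, dfun D H f = dfun E H f) -> D = E.
Proof.
case: D E => d1 a1 b1 c1 e1 [d2 a2 b2 c2 e2] /= eqd.
have {}eqd : d1 = d2.
  apply: functional_extensionality_dep => V.
  apply: functional_extensionality_dep => H.
  by apply: funext => f; exact: eqd.
case: _ / eqd in a2 b2 c2 e2 *.
by congr Der; exact: Prop_irrelevance.
Qed.

Section Ops.
Variable U : openset X.

Program Definition der0 : der U := @Der U (fun V H f => 0) _ _ _ _.
Next Obligation. by move=> V H f g /=; rewrite addr0. Qed.
Next Obligation. by move=> V H f g /=; rewrite !mulr0 addr0. Qed.
Next Obligation. by []. Qed.
Next Obligation. by move=> V W HV HW HWV f /=; rewrite ores0. Qed.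

Program Definition derN (D : der U) : der U :=
  @Der U (fun V H f => - dfun D H f) _ _ _ _.
Next Obligation. by move=> D V H f g /=; rewrite dfunD opprD. Qed.
Next Obligation. by move=> D V H f g /=; rewrite dfunM opprD !mulrN. Qed.
Next Obligation. by move=> D V H c /=; rewrite dfun_cst oppr0. Qed.
Next Obligation.
by move=> D V W HV HW HWV f /=; rewrite oresN (dfun_res _ HV HW).
Qed.

Program Definition derD (D E : der U) : der U :=
  @Der U (fun V H f => dfun D H f + dfun E H f) _ _ _ _.
Next Obligation. by move=> D E V H f g /=; rewrite !dfunD addrACA. Qed.
Next Obligation. by move=> D E V H f g /=; rewrite !dfunM !mulrDr addrACA. Qed.
Next Obligation. by move=> D E V H c /=; rewrite !dfun_cst addr0. Qed.
Next Obligation.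
by move=> D E V W HV HW HWV f /=; rewrite oresD !(dfun_res _ HV HW).
Qed.

Program Definition derZ (a : O U) (D : der U) : der U :=
  @Der U (fun V H f => ores H a * dfun D H f) _ _ _ _.
Next Obligation. by move=> a D V H f g /=; rewrite dfunD mulrDr. Qed.
Next Obligation.
by move=> a D V H f g /=; rewrite dfunM mulrDr !(mulrCA (ores H a)).
Qed.
Next Obligation. by move=> a D V H c /=; rewrite dfun_cst mulr0. Qed.
Next Obligation.
move=> a D V W HV HW HWV f /=.
by rewrite oresM (dfun_res _ HV HW) (ores_comp HV HWV HW).
Qed.

HB.instance Definition _ := gen_eqMixin (der U).
HB.instance Definition _ := gen_choiceMixin (der U).

Fact derDA : associative derD.
Proof. by move=> D E F; apply: der_ext => V H f /=; rewrite addrA. Qed.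
Fact derDC : commutative derD.
Proof. by move=> D E; apply: der_ext => V H f /=; rewrite addrC. Qed.
Fact der0D : left_id der0 derD.
Proof. by move=> D; apply: der_ext => V H f /=; rewrite add0r. Qed.
Fact derND : left_inverse der0 derN derD.
Proof. by move=> D; apply: der_ext => V H f /=; rewrite addNr. Qed.

HB.instance Definition _ :=
  GRing.isZmodule.Build (der U) derDA derDC der0D derND.

Fact derZA a b D : derZ a (derZ b D) = derZ (a * b) D.
Proof. by apply: der_ext => V H f /=; rewrite oresM mulrA. Qed.
Fact der1Z : left_id 1 derZ.
Proof. by move=> D; apply: der_ext => V H f /=; rewrite ores1 mul1r. Qed.
Fact derZDr : right_distributive derZ +%R.
Proof. by move=> a D E; apply: der_ext => V H f /=; rewrite mulrDr. Qed.
Fact derZDl D : {morph derZ^~ D : a b / a + b}.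
Proof. by move=> a b; apply: der_ext => V H f /=; rewrite oresD mulrDl. Qed.

HB.instance Definition _ :=
  GRing.Zmodule_isLmodule.Build (O U) (der U) derZA der1Z derZDr derZDl.

End Ops.

Program Definition der_res (U V : openset X) (H : V `<=` U) (D : der U) :
  der V := @Der V (fun W HW f => dfun D (subset_trans HW H) f) _ _ _ _.
Next Obligation. by move=> U V H D W HW f g /=; rewrite dfunD. Qed.
Next Obligation. by move=> U V H D W HW f g /=; rewrite dfunM. Qed.
Next Obligation. by move=> U V H D W HW c /=; rewrite dfun_cst. Qed.
Next Obligation. by move=> U V H D V' W HV HW HWV f; exact: dfun_res. Qed.

(* T_X *)
Program Definition tangent : omodule X :=
  @OModule R X (fun U => der U) der_res _ _ _ _.
Next Obligation. by move=> U V H D E; exact: der_ext. Qed.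
Next Obligation.
move=> U V H a D; apply: der_ext => W HW f /=.
by rewrite (ores_comp _ _ (subset_trans HW H)).
Qed.
Next Obligation.
move=> U H D; apply: der_ext => W HW f /=.
by congr (dfun D _ f); exact: Prop_irrelevance.
Qed.
Next Obligation.
move=> U V W HVU HWV HWU D; apply: der_ext => W' HW' f /=.
by congr (dfun D _ f); exact: Prop_irrelevance.
Qed.

End Derivations.

Section Groups.
Variables (R : realType) (X : fspace R).
Local Notation C := R[i].

(* O_X^*(U) *)
Record ounit (U : openset X) := OUnit {
  uval : O U;
  uinv : O U;
  uvalV : uval * uinv = 1
}.

Lemma ounit_ext U (u v : ounit U) : uval u = uval v -> u = v.
Proof.
case: u v => u u' uu' [v v' vv'] /= uv; case: _ / uv in v' vv' *.
have v'E : u' = v' by rewrite -[LHS]mulr1 -vv' mulrA (mulrC u') uu' mul1r.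
by case: _ / v'E in vv' *; congr OUnit; exact: Prop_irrelevance.
Qed.

Section UnitGroup.
Variable U : openset X.

Definition unit1 : ounit U := OUnit (mulr1 (1 : O U)).

Program Definition unitM (u v : ounit U) : ounit U :=
  @OUnit U (uval u * uval v) (uinv u * uinv v) _.
Next Obligation. by move=> u v; rewrite mulrACA !uvalV mulr1. Qed.

Program Definition unitV (u : ounit U) : ounit U :=
  @OUnit U (uinv u) (uval u) _.
Next Obligation. by move=> u; rewrite mulrC uvalV. Qed.

HB.instance Definition _ := gen_eqMixin (ounit U).
HB.instance Definition _ := gen_choiceMixin (ounit U).

Fact unitMA : associative unitM.
Proof. by move=> u v w; apply: ounit_ext; rewrite /= mulrA. Qed.
Fact unit1M : left_id unit1 unitM.
Proof. by move=> u; apply: ounit_ext; rewrite /= mul1r. Qed.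
Fact unitM1 : right_id unit1 unitM.
Proof. by move=> u; apply: ounit_ext; rewrite /= mulr1. Qed.
Fact unitVM : left_inverse unit1 unitV unitM.
Proof. by move=> u; apply: ounit_ext; rewrite /= mulrC uvalV. Qed.
Fact unitMV : right_inverse unit1 unitV unitM.
Proof. by move=> u; apply: ounit_ext; rewrite /= uvalV. Qed.

HB.instance Definition _ :=
  isGroup.Build (ounit U) unitMA unit1M unitM1 unitVM unitMV.

End UnitGroup.

Program Definition unit_res (U V : openset X) (H : V `<=` U) (u : ounit U) :
  ounit V := @OUnit V (ores H (uval u)) (ores H (uinv u)) _.
Next Obligation. by move=> U V H u; rewrite -oresM uvalV ores1. Qed.

End Groups.

(* A[t]/(t^2), with (a, b) standing for a + bt. *)
Definition dual (A : comPzRingType) : Type := (A * A)%type.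

Section Dual.
Variable A : comPzRingType.
Local Notation D := (dual A).

HB.instance Definition _ := GRing.Zmodule.copy D (A * A)%type.

Definition dual_one : D := (1, 0).
Definition dual_mul (p q : D) : D := (p.1 * q.1, p.1 * q.2 + p.2 * q.1).

Fact dual_mulA : associative dual_mul.
Proof.
move=> p q r; rewrite /dual_mul /= !mulrDr !mulrDl !mulrA addrA.
by [].
Qed.
Fact dual_mulC : commutative dual_mul.
Proof.
move=> p q; rewrite /dual_mul (mulrC p.1) (mulrC p.1) (mulrC p.2).
by rewrite [X in (_, X)]addrC.
Qed.
Fact dual_mul1 : left_id dual_one dual_mul.
Proof. by move=> [a b]; rewrite /dual_mul /= !mul1r mul0r addr0. Qed.
Fact dual_mulD : left_distributive dual_mul +%R.
Proof.
move=> p q r; rewrite /dual_mul /= [RHS]/GRing.add /= /add_pair /=.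
by rewrite !mulrDl addrACA.
Qed.

HB.instance Definition _ :=
  GRing.Zmodule_isComPzRing.Build D dual_mulA dual_mulC dual_mul1 dual_mulD.

End Dual.

Section G2.
Variables (R : realType) (X : fspace R).
Local Notation C := R[i].

Definition dual_res (U V : openset X) (H : V `<=` U) (p : dual (O U)) :
  dual (O V) := (ores H p.1, ores H p.2).

(* Automorphisms of the sheaf of C-algebras O_U[t]/(t^2) inducing the         *)
(* identity on O_U, with their inverses; C-linearity amounts to fixing the    *)
(* constants.                                                                 *)
Record G2 (U : openset X) := MkG2 {
  gfun : forall V : openset X, V `<=` U -> dual (O V) -> dual (O V);
  ginv : forall V : openset X, V `<=` U -> dual (O V) -> dual (O V);
  gfunK : forall (V : openset X) (H : V `<=` U), cancel (gfun H) (ginv H);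
  ginvK : forall (V : openset X) (H : V `<=` U), cancel (ginv H) (gfun H);
  gfunD : forall (V : openset X) (H : V `<=` U),
    {morph gfun H : p q / p + q};
  gfunM : forall (V : openset X) (H : V `<=` U),
    {morph gfun H : p q / p * q};
  gfun_cst : forall (V : openset X) (H : V `<=` U) (c : C),
    gfun H (ocst V c, 0) = (ocst V c, 0);
  gfun_mod : forall (V : openset X) (H : V `<=` U) (p : dual (O V)),
    (gfun H p).1 = p.1;
  gfun_res : forall (V W : openset X) (HV : V `<=` U) (HW : W `<=` U)
    (HWV : W `<=` V) (p : dual (O V)),
    dual_res HWV (gfun HV p) = gfun HW (dual_res HWV p)
}.

Lemma G2_ext U (g h : G2 U) :
  (forall (V : openset X) (H : V `<=` U) p, gfun g H p = gfun h H p) -> g = h.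
Proof.
case: g h => f f' fK f'K fD fM fC fm fr [h h' hK h'K hD hM hC hm hr] /= fh.
have {}fh : f = h.
  apply: functional_extensionality_dep => V.
  apply: functional_extensionality_dep => H.
  by apply: funext => p; exact: fh.
case: _ / fh in hK h'K hD hM hC hm hr *.
have f'h' : f' = h'.
  apply: functional_extensionality_dep => V.
  apply: functional_extensionality_dep => H.
  by apply: funext => p; rewrite -[in LHS](h'K V H p) fK.
case: _ / f'h' in hK h'K *.
by congr MkG2; exact: Prop_irrelevance.
Qed.

Section Ops.
Variable U : openset X.

Program Definition G2_one : G2 U :=
  @MkG2 U (fun V H p => p) (fun V H p => p) _ _ _ _ _ _ _.
Solve All Obligations with by [].

Program Definition G2_mul (g h : G2 U) : G2 U :=
  @MkG2 U (fun V H p => gfun g H (gfun h H p))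
    (fun V H p => ginv h H (ginv g H p)) _ _ _ _ _ _ _.
Next Obligation. by move=> g h V H p /=; rewrite !gfunK. Qed.
Next Obligation. by move=> g h V H p /=; rewrite !ginvK. Qed.
Next Obligation. by move=> g h V H p q /=; rewrite !gfunD. Qed.
Next Obligation. by move=> g h V H p q /=; rewrite !gfunM. Qed.
Next Obligation. by move=> g h V H c /=; rewrite !gfun_cst. Qed.
Next Obligation. by move=> g h V H p /=; rewrite !gfun_mod. Qed.
Next Obligation.
by move=> g h V W HV HW HWV p /=; rewrite !(gfun_res _ HV HW).
Qed.

Program Definition G2_inv (g : G2 U) : G2 U :=
  @MkG2 U (fun V H p => ginv g H p) (fun V H p => gfun g H p) _ _ _ _ _ _ _.
Next Obligation. by move=> g V H p /=; rewrite ginvK. Qed.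
Next Obligation. by move=> g V H p /=; rewrite gfunK. Qed.
Next Obligation.
move=> g V H p q /=; apply: (can_inj (gfunK g H)).
by rewrite gfunD !ginvK.
Qed.
Next Obligation.
move=> g V H p q /=; apply: (can_inj (gfunK g H)).
by rewrite gfunM !ginvK.
Qed.
Next Obligation.
by move=> g V H c /=; apply: (can_inj (gfunK g H)); rewrite ginvK gfun_cst.
Qed.
Next Obligation. by move=> g V H p /=; rewrite -(gfun_mod g H) ginvK. Qed.
Next Obligation.
move=> g V W HV HW HWV p /=; apply: (can_inj (gfunK g HW)).
by rewrite -(gfun_res _ HV HW) !ginvK.
Qed.

HB.instance Definition _ := gen_eqMixin (G2 U).
HB.instance Definition _ := gen_choiceMixin (G2 U).

Fact G2_mulA : associative G2_mul.
Proof. by move=> f g h; exact: G2_ext. Qed.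
Fact G2_mul1l : left_id G2_one G2_mul.
Proof. by move=> g; exact: G2_ext. Qed.
Fact G2_mul1r : right_id G2_one G2_mul.
Proof. by move=> g; exact: G2_ext. Qed.
Fact G2_mulV : left_inverse G2_one G2_inv G2_mul.
Proof. by move=> g; apply: G2_ext => V H p /=; rewrite gfunK. Qed.
Fact G2_mulVr : right_inverse G2_one G2_inv G2_mul.
Proof. by move=> g; apply: G2_ext => V H p /=; rewrite ginvK. Qed.

(* The group law is composition: (g * h)(p) = g(h(p)). *)
HB.instance Definition _ :=
  isGroup.Build (G2 U) G2_mulA G2_mul1l G2_mul1r G2_mulV G2_mulVr.

(* xi_2(g) = alpha, where g(t) = alpha t. *)
Program Definition xi2 (g : G2 U) : ounit U :=
  @OUnit R X U (gfun g (@subset_refl _ U) (0, 1)).2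
               (ginv g (@subset_refl _ U) (0, 1)).2 _.
Next Obligation.
move=> g; set H := @subset_refl _ _.
set q := ginv g H (0, 1).
have q1 : q.1 = 0 by rewrite -(gfun_mod g H) ginvK.
have qE : q = ((q.2, 0) : dual (O U)) * (0, 1).
  rewrite [LHS]surjective_pairing q1 [RHS]/GRing.mul /= /dual_mul /=.
  by rewrite !mulr0 mulr1 addr0.
have gq : gfun g H q = (0, 1) by exact: ginvK.
move: gq; rewrite {1}qE gfunM => /(congr1 snd) /=.
by rewrite !gfun_mod /= mulr0 addr0 mulrC.
Qed.

(* The automorphism f + bt |-> f + (D(f) + b)t of ker(xi_2). *)
Program Definition iota (D : der U) : G2 U :=
  @MkG2 U (fun V H p => (p.1, dfun D H p.1 + p.2))
    (fun V H p => (p.1, p.2 - dfun D H p.1)) _ _ _ _ _ _ _.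
Next Obligation. by move=> D V H [a b] /=; rewrite addrAC subrr add0r. Qed.
Next Obligation. by move=> D V H [a b] /=; rewrite addrC subrK. Qed.
Next Obligation.
move=> D V H p q /=; rewrite dfunD [RHS]/GRing.add /= /add_pair /=.
by rewrite addrACA.
Qed.
Next Obligation.
move=> D V H p q /=; rewrite dfunM [RHS]/GRing.mul /= /dual_mul /=.
by rewrite !mulrDr !mulrDl (mulrC q.1) addrACA.
Qed.
Next Obligation. by move=> D V H c /=; rewrite dfun_cst addr0. Qed.
Next Obligation. by []. Qed.
Next Obligation.
move=> D V W HV HW HWV p /=; rewrite /dual_res /=.
by rewrite oresD (dfun_res _ HV HW).
Qed.

(* The automorphism f |-> f, t |-> ut. *)
Program Definition diag (u : ounit U) : G2 U :=
  @MkG2 U (fun V H p => (p.1, ores H (uval u) * p.2))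
    (fun V H p => (p.1, ores H (uinv u) * p.2)) _ _ _ _ _ _ _.
Next Obligation.
move=> u V H [a b] /=.
by rewrite mulrA -oresM (mulrC (uinv u)) uvalV ores1 mul1r.
Qed.
Next Obligation.
by move=> u V H [a b] /=; rewrite mulrA -oresM uvalV ores1 mul1r.
Qed.
Next Obligation.
by move=> u V H p q /=; rewrite mulrDr [RHS]/GRing.add.
Qed.
Next Obligation.
move=> u V H p q /=; rewrite [RHS]/GRing.mul /= /dual_mul /=.
by rewrite mulrDr (mulrCA p.1) -[_ * p.2 * _]mulrA.
Qed.
Next Obligation. by move=> u V H c /=; rewrite mulr0. Qed.
Next Obligation. by []. Qed.
Next Obligation.
move=> u V W HV HW HWV p /=; rewrite /dual_res /=.
by rewrite oresM (ores_comp HV HWV HW).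
Qed.

(* D' = u.D for the action of O_X^* on T_X induced by the conjugation action  *)
(* of G_2 on ker(xi_2).                                                       *)
Definition unit_act (u : ounit U) (D D' : der U) : Prop :=
  exists g : G2 U, xi2 g = u /\ iota D' = (g * iota D * g^-1)%g.

End Ops.
End G2.

(* The tensor product of A-modules: formal sums of pairs (m, n), i.e. the     *)
(* free commutative monoid on M x N, modulo the congruence generated by the   *)
(* bilinearity relations.                                                     *)
Section TensorModule.
Variables (A : comPzRingType) (M N : lmodType A).

Inductive tens_eq : seq (M * N) -> seq (M * N) -> Prop :=
| tens_refl s : tens_eq s s
| tens_sym s t : tens_eq s t -> tens_eq t s
| tens_trans s t u : tens_eq s t -> tens_eq t u -> tens_eq s u
| tens_cat s s' t t' : tens_eq s s' -> tens_eq t t' ->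
    tens_eq (s ++ t) (s' ++ t')
| tens_comm s t : tens_eq (s ++ t) (t ++ s)
| tens_zero n : tens_eq [:: (0, n)] [::]
| tens_addl m m' n : tens_eq [:: (m + m', n)] [:: (m, n); (m', n)]
| tens_addr m n n' : tens_eq [:: (m, n + n')] [:: (m, n); (m, n')]
| tens_bal a m n : tens_eq [:: (a *: m, n)] [:: (m, a *: n)].

Definition tens_rel : rel (seq (M * N)) := fun s t => `[< tens_eq s t >].

Fact tens_rel_refl : reflexive tens_rel.
Proof. by move=> s; apply/asboolP; exact: tens_refl. Qed.
Fact tens_rel_sym : symmetric tens_rel.
Proof. by move=> s t; apply/asboolP/asboolP; exact: tens_sym. Qed.
Fact tens_rel_trans : transitive tens_rel.
Proof.
by move=> t s u /asboolP st /asboolP tu; apply/asboolP; exact: tens_trans tu.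
Qed.

Canonical tens_equiv :=
  EquivRel tens_rel tens_rel_refl tens_rel_sym tens_rel_trans.

Definition tens : Type := {eq_quot tens_equiv}.
HB.instance Definition _ := Choice.on tens.
HB.instance Definition _ := EqQuotient.on tens.

Lemma tensP s t : (\pi_tens s = \pi_tens t) <-> tens_eq s t.
Proof. by split=> [/eqmodP/asboolP//|st]; apply/eqmodP/asboolP. Qed.

Definition tens0 : tens := \pi_tens [::].
Definition tensD (x y : tens) : tens := \pi_tens (repr x ++ repr y).
Definition tensN (x : tens) : tens := \pi_tens [seq (- p.1, p.2) | p <- repr x].
Definition tensZ (a : A) (x : tens) : tens :=
  \pi_tens [seq (a *: p.1, p.2) | p <- repr x].

Lemma tens_repr s : tens_eq (repr (\pi_tens s)) s.
Proof. by apply/tensP; rewrite reprK. Qed.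

Lemma tensDE s t : tensD (\pi s) (\pi t) = \pi_tens (s ++ t).
Proof. by apply/tensP/tens_cat; exact: tens_repr. Qed.

Lemma tens_eqZ a s t : tens_eq s t ->
  tens_eq [seq (a *: p.1, p.2) | p <- s] [seq (a *: p.1, p.2) | p <- t].
Proof.
elim=> /=.
- by move=> *; exact: tens_refl.
- by move=> *; exact: tens_sym.
- by move=> s' t' u _ + _; exact: tens_trans.
- by move=> *; rewrite !map_cat; exact: tens_cat.
- by move=> *; rewrite !map_cat; exact: tens_comm.
- by move=> n; rewrite scaler0; exact: tens_zero.
- by move=> *; rewrite scalerDr; exact: tens_addl.
- by move=> *; exact: tens_addr.
- by move=> b m n; rewrite scalerA mulrC -scalerA; exact: tens_bal.
Qed.

Lemma tensNZ s : [seq (- p.1, p.2) | p <- s] =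
  [seq ((-1 : A) *: p.1, p.2) | p <- s] :> seq (M * N).
Proof. by apply: eq_map => p; rewrite scaleN1r. Qed.

Lemma tensZE a s : tensZ a (\pi s) = \pi_tens [seq (a *: p.1, p.2) | p <- s].
Proof. by apply/tensP/tens_eqZ; exact: tens_repr. Qed.

Lemma tensNE s : tensN (\pi s) = \pi_tens [seq (- p.1, p.2) | p <- s].
Proof. by rewrite /tensN !tensNZ; exact: tensZE. Qed.

Fact tensDA : associative tensD.
Proof.
by elim/quotW=> s; elim/quotW=> t; elim/quotW=> u; rewrite !tensDE catA.
Qed.
Fact tensDC : commutative tensD.
Proof.
by elim/quotW=> s; elim/quotW=> t; rewrite !tensDE; apply/tensP/tens_comm.
Qed.
Fact tens0D : left_id tens0 tensD.
Proof. by elim/quotW=> s; rewrite tensDE. Qed.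

Lemma tens_eqN s : tens_eq ([seq (- p.1, p.2) | p <- s] ++ s) [::].
Proof.
elim: s => [|[m n] s IHs] /=; first exact: tens_refl.
pose t := [:: (- m, n); (m, n)] ++ ([seq (- p.1, p.2) | p <- s] ++ s).
apply: (@tens_trans _ t).
  rewrite -cat1s /t -[_ :: _ :: _]cat1s -catA; apply: tens_cat (tens_refl _) _.
  rewrite -[(m, n) :: s]cat1s !catA; apply: tens_cat (tens_refl _).
  exact: tens_comm.
apply: (@tens_cat _ [::] _ [::]) => //.
apply: tens_trans (tens_zero n); rewrite -(addNr m).
by apply: tens_sym; exact: tens_addl.
Qed.

Fact tensND : left_inverse tens0 tensN tensD.
Proof.
by elim/quotW=> s; rewrite tensNE tensDE; apply/tensP; exact: tens_eqN.
Qed.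

HB.instance Definition _ :=
  GRing.isZmodule.Build tens tensDA tensDC tens0D tensND.

Fact tensZA a b x : tensZ a (tensZ b x) = tensZ (a * b) x.
Proof.
elim/quotW: x => s; rewrite !tensZE -map_comp; congr \pi_tens.
by apply: eq_map => p /=; rewrite scalerA.
Qed.
Fact tens1Z : left_id 1 tensZ.
Proof.
elim/quotW=> s; rewrite tensZE; congr \pi_tens; rewrite -[RHS]map_id.
by apply: eq_map => -[m n] /=; rewrite scale1r.
Qed.
Fact tensZDr : right_distributive tensZ +%R.
Proof.
move=> a; elim/quotW=> s; elim/quotW=> t.
by rewrite [_ + _]tensDE !tensZE [RHS]tensDE map_cat.
Qed.

Lemma tens_eqZD a b s : tens_eq [seq ((a + b) *: p.1, p.2) | p <- s]
  ([seq (a *: p.1, p.2) | p <- s] ++ [seq (b *: p.1, p.2) | p <- s]).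
Proof.
elim: s => [|[m n] s IHs] /=; first exact: tens_refl.
pose t := [:: (a *: m, n); (b *: m, n)] ++
  ([seq (a *: p.1, p.2) | p <- s] ++ [seq (b *: p.1, p.2) | p <- s]).
apply: (@tens_trans _ t).
  by rewrite -cat1s; apply: tens_cat => //; rewrite scalerDl; exact: tens_addl.
rewrite /t -[_ :: _ :: _]cat1s -catA -[X in tens_eq _ X]cat1s.
apply: tens_cat (tens_refl _) _.
rewrite -[X in tens_eq _ (_ ++ X)]cat1s !catA; apply: tens_cat (tens_refl _).
exact: tens_comm.
Qed.

Fact tensZDl x : {morph tensZ^~ x : a b / a + b}.
Proof.
elim/quotW: x => s a b; rewrite !tensZE [RHS]tensDE.
by apply/tensP; exact: tens_eqZD.
Qed.

HB.instance Definition _ :=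
  GRing.Zmodule_isLmodule.Build A tens tensZA tens1Z tensZDr tensZDl.

End TensorModule.

Section PresheafTensor.
Variables (R : realType) (X : fspace R) (M N : omodule X).

Section Res.
Variables (U V : openset X) (H : V `<=` U).

Definition pair_res (p : M U * N U) : M V * N V := (mres H p.1, mres H p.2).

Lemma tens_eq_res (s t : seq (M U * N U)) :
  tens_eq s t -> tens_eq (map pair_res s) (map pair_res t).
Proof.
elim=> /=.
- by move=> *; exact: tens_refl.
- by move=> *; exact: tens_sym.
- by move=> s' t' u _ + _; exact: tens_trans.
- by move=> *; rewrite !map_cat; exact: tens_cat.
- by move=> *; rewrite !map_cat; exact: tens_comm.
- move=> n; by rewrite /pair_res /= mres0; exact: tens_zero.
- by move=> *; rewrite /pair_res /= mresD; exact: tens_addl.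
- by move=> *; rewrite /pair_res /= mresD; exact: tens_addr.
- by move=> *; rewrite /pair_res /= !mresZ; exact: tens_bal.
Qed.

Definition ptens_res (x : tens (M U) (N U)) : tens (M V) (N V) :=
  \pi_(tens _ _) (map pair_res (repr x)).

Lemma ptens_resE s : ptens_res (\pi s) = \pi_(tens _ _) (map pair_res s).
Proof. by apply/tensP/tens_eq_res; exact: tens_repr. Qed.

End Res.

(* U |-> M(U) (x) N(U) over O_X(U) *)
Program Definition ptensor : omodule X :=
  @OModule R X (fun U => tens (M U) (N U)) ptens_res _ _ _ _.
Next Obligation.
move=> U V H; elim/quotW=> s; elim/quotW=> t.
by rewrite [_ + _]tensDE !ptens_resE [RHS]tensDE map_cat.
Qed.
Next Obligation.
move=> U V H a; elim/quotW=> s.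
rewrite [_ *: _]tensZE !ptens_resE [RHS]tensZE -!map_comp; congr \pi_(tens _ _).
by apply: eq_map => p; rewrite /pair_res /= mresZ.
Qed.
Next Obligation.
move=> U H; elim/quotW=> s; rewrite ptens_resE; congr \pi_(tens _ _).
rewrite -[RHS]map_id; apply: eq_map => -[m n].
by rewrite /pair_res /= !mres_id.
Qed.
Next Obligation.
move=> U V W HVU HWV HWU; elim/quotW=> s; rewrite !ptens_resE -map_comp.
congr \pi_(tens _ _); apply: eq_map => p.
by rewrite /pair_res /= !(mres_comp HVU HWV HWU).
Qed.

End PresheafTensor.

Section Sheafification.
Variables (R : realType) (X : fspace R) (F : omodule X).

Section Stalk.
Variable x : X.

Record germ_rep := GermRep {
  gset : openset X;
  gmem : gset x;
  gsec : F gset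
}.

HB.instance Definition _ := gen_eqMixin germ_rep.
HB.instance Definition _ := gen_choiceMixin germ_rep.

Definition germ_eq (g h : germ_rep) : Prop :=
  exists (W : openset X) (Wg : W `<=` gset g) (Wh : W `<=` gset h),
    W x /\ mres Wg (gsec g) = mres Wh (gsec h).

Definition germ_rel : rel germ_rep := fun g h => `[< germ_eq g h >].

Fact germ_rel_refl : reflexive germ_rel.
Proof.
move=> g; apply/asboolP; exists (gset g), (@subset_refl _ _), (@subset_refl _ _).
by split => //; exact: gmem.
Qed.
Fact germ_rel_sym : symmetric germ_rel.
Proof.
by move=> g h; apply/asboolP/asboolP => -[W [Wg [Wh [Wx e]]]];
  exists W, Wh, Wg.
Qed.
Fact germ_rel_trans : transitive germ_rel.
Proof.
move=> h g k /asboolP[W [Wg [Wh [Wx e]]]] /asboolP[W' [W'h [W'k [W'x e']]]].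
apply/asboolP; exists (oI W W').
exists (subset_trans (@oI_l _ W W') Wg), (subset_trans (@oI_r _ W W') W'k).
split=> //.
rewrite -(mres_comp Wg (@oI_l _ W W')) e -(mres_comp W'k (@oI_r _ W W')) -e'.
by rewrite !(mres_comp _ _ (subset_trans (@oI_l _ W W') Wh)).
Qed.

Canonical germ_equiv :=
  EquivRel germ_rel germ_rel_refl germ_rel_sym germ_rel_trans.

Definition stalk : Type := {eq_quot germ_equiv}.
HB.instance Definition _ := Choice.on stalk.
HB.instance Definition _ := EqQuotient.on stalk.

Definition germ (V : openset X) (Vx : V x) (s : F V) : stalk :=
  \pi_stalk (GermRep Vx s).

Lemma germP (V W : openset X) (Vx : V x) (Wx : W x) (s : F V) (t : F W) :
  germ Vx s = germ Wx t <-> germ_eq (GermRep Vx s) (GermRep Wx t).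
Proof. by split=> [/eqmodP/asboolP//|st]; apply/eqmodP/asboolP. Qed.

Lemma germ_mres (U V : openset X) (H : V `<=` U) (Ux : U x) (Vx : V x)
  (s : F U) : germ Vx (mres H s) = germ Ux s.
Proof.
apply/germP; exists V, (@subset_refl _ _), H; split => //.
by rewrite mres_id.
Qed.

Lemma stalkW (P : stalk -> Prop) :
  (forall (V : openset X) (Vx : V x) (s : F V), P (germ Vx s)) ->
  forall a, P a.
Proof. by move=> Pg; elim/quotW => -[V Vx s]; exact: Pg. Qed.

Definition stalk0 : stalk := germ (I : oT x) 0.

Definition stalkD (a b : stalk) : stalk :=
  let g := repr a in let h := repr b in
  germ (conj (gmem g) (gmem h) : oI (gset g) (gset h) x)
    (mres (@oI_l _ _ _) (gsec g) + mres (@oI_r _ _ _) (gsec h)).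

Definition stalkN (a : stalk) : stalk :=
  let g := repr a in germ (gmem g) (- gsec g).

Definition stalkZ (U : openset X) (Ux : U x) (f : O U) (a : stalk) : stalk :=
  let g := repr a in
  germ (conj Ux (gmem g) : oI U (gset g) x)
    (ores (@oI_l _ _ _) f *: mres (@oI_r _ _ _) (gsec g)).

Lemma repr_germ (V : openset X) (Vx : V x) (s : F V) :
  germ_eq (repr (germ Vx s)) (GermRep Vx s).
Proof.
have := reprK (germ Vx s); rewrite {2}/germ.
by move=> /eqmodP/asboolP.
Qed.

Lemma germD (V : openset X) (Vx : V x) (s t : F V) :
  stalkD (germ Vx s) (germ Vx t) = germ Vx (s + t).
Proof.
rewrite /stalkD; have := repr_germ Vx s; have := repr_germ Vx t.
case: (repr _) => /= V2 V2x t' [W2 /= [W2t' [W2t [W2x e2]]]].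
case: (repr _) => /= V1 V1x s' [W1 /= [W1s' [W1s [W1x e1]]]].
apply/germP; exists (oI W1 W2), (oIS W1s' W2t').
exists (subset_trans (@oI_l _ W1 W2) W1s); split; first by split.
rewrite /= !mresD !(mres_comp _ _ (subset_trans (@oI_l _ W1 W2) W1s'))
  !(mres_comp _ _ (subset_trans (@oI_r _ W1 W2) W2t')).
rewrite -(mres_comp W1s' (@oI_l _ W1 W2)) e1.
rewrite -(mres_comp W2t' (@oI_r _ W1 W2)) e2.
by rewrite !(mres_comp _ _ (subset_trans (@oI_l _ W1 W2) W1s)).
Qed.

Lemma germN (V : openset X) (Vx : V x) (s : F V) :
  stalkN (germ Vx s) = germ Vx (- s).
Proof.
rewrite /stalkN; have := repr_germ Vx s.
case: (repr _) => /= V1 V1x s' [W1 /= [W1s' [W1s [W1x e1]]]].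
by apply/germP; exists W1, W1s', W1s; split => //=; rewrite !mresN e1.
Qed.

Lemma germ0 (V : openset X) (Vx : V x) : stalk0 = germ Vx 0.
Proof.
apply/germP; exists V, (fun y _ => I : oT y), (@subset_refl _ _).
by split => //=; rewrite !mres0.
Qed.

Lemma germZ (U V : openset X) (Ux : U x) (H : V `<=` U) (Vx : V x) (f : O U)
  (s : F V) : stalkZ Ux f (germ Vx s) = germ Vx (ores H f *: s).
Proof.
rewrite /stalkZ; have := repr_germ Vx s.
case: (repr _) => /= V1 V1x s' [W1 /= [W1s' [W1s [W1x e1]]]].
apply/germP; exists W1, (oI_sub (subset_trans W1s H) W1s'), W1s.
split => //=; rewrite !mresZ !(ores_comp _ _ (subset_trans W1s H)).
by rewrite (mres_comp _ _ W1s') e1.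
Qed.

Lemma stalk_common (U : openset X) (Ux : U x) (a b c : stalk) :
  exists (V : openset X) (H : V `<=` U) (Vx : V x) (s t u : F V),
    [/\ a = germ Vx s, b = germ Vx t & c = germ Vx u].
Proof.
elim/stalkW: a => V1 V1x s; elim/stalkW: b => V2 V2x t.
elim/stalkW: c => V3 V3x u.
pose V := oI U (oI V1 (oI V2 V3)).
have HU : V `<=` U by move=> y [].
have H1 : V `<=` V1 by move=> y [_ []].
have H2 : V `<=` V2 by move=> y [_ [_ []]].
have H3 : V `<=` V3 by move=> y [_ [_ []]].
have Vx : V x by [].
exists V, HU, Vx, (mres H1 s), (mres H2 t), (mres H3 u).
by rewrite (germ_mres H1 V1x) (germ_mres H2 V2x) (germ_mres H3 V3x).
Qed.

Fact stalkDA : associative stalkD.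
Proof.
move=> a b c; have [V [_ [Vx [s [t [u [-> -> ->]]]]]]] :=
  stalk_common (I : oT x) a b c.
by rewrite !germD addrA.
Qed.
Fact stalkDC : commutative stalkD.
Proof.
move=> a b; have [V [_ [Vx [s [t [_ [-> -> _]]]]]]] :=
  stalk_common (I : oT x) a b b.
by rewrite !germD addrC.
Qed.
Fact stalk0D : left_id stalk0 stalkD.
Proof.
by elim/stalkW => V Vx s; rewrite (germ0 Vx) germD add0r.
Qed.
Fact stalkND : left_inverse stalk0 stalkN stalkD.
Proof.
by elim/stalkW => V Vx s; rewrite germN germD addNr -germ0.
Qed.

HB.instance Definition _ :=
  GRing.isZmodule.Build stalk stalkDA stalkDC stalk0D stalkND.

Section Scale.
Variables (U : openset X) (Ux : U x).

Lemma stalkZA f g a : stalkZ Ux f (stalkZ Ux g a) = stalkZ Ux (f * g) a.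
Proof.
have [V [H [Vx [s [_ [_ [-> _ _]]]]]]] := stalk_common Ux a a a.
by rewrite !(germZ Ux H) scalerA oresM.
Qed.

Lemma stalk1Z a : stalkZ Ux 1 a = a.
Proof.
have [V [H [Vx [s [_ [_ [-> _ _]]]]]]] := stalk_common Ux a a a.
by rewrite (germZ Ux H) ores1 scale1r.
Qed.

Lemma stalkZDr f a b : stalkZ Ux f (a + b) = stalkZ Ux f a + stalkZ Ux f b.
Proof.
have [V [H [Vx [s [t [_ [-> -> _]]]]]]] := stalk_common Ux a b b.
by rewrite [_ + _]germD !(germZ Ux H) [RHS]germD scalerDr.
Qed.

Lemma stalkZDl a f g : stalkZ Ux (f + g) a = stalkZ Ux f a + stalkZ Ux g a.
Proof.
have [V [H [Vx [s [_ [_ [-> _ _]]]]]]] := stalk_common Ux a a a.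
by rewrite !(germZ Ux H) [RHS]germD oresD scalerDl.
Qed.

End Scale.
End Stalk.

(* Sections over U: families of germs (sigma_x), x in U, which locally are    *)
(* the germs of a section of F.                                               *)
Record shsec (U : openset X) := ShSec {
  shfun : forall x : pts U, stalk (sval x);
  shloc : forall x : pts U, exists (V : openset X) (H : V `<=` U) (s : F V),
    V (sval x) /\ forall y : pts V, shfun (incl H y) = germ (proj2_sig y) s
}.

Lemma shsec_ext U (a b : shsec U) :
  (forall x, shfun a x = shfun b x) -> a = b.
Proof.
case: a b => a aP [b bP] /= ab.
have {}ab : a = b by exact: functional_extensionality_dep.
by case: _ / ab in bP *; congr ShSec; exact: Prop_irrelevance.
Qed.

Lemma shfun_irr U (a : shsec U) x (p q : U x) :
  shfun a (exist _ x p) = shfun a (exist _ x q).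
Proof. by rewrite (Prop_irrelevance p q). Qed.

Section Ops.
Variable U : openset X.

Program Definition sh0 : shsec U := @ShSec U (fun x => 0) _.
Next Obligation.
move=> x; exists U, (@subset_refl _ _), 0; split; first exact: proj2_sig.
by move=> y; exact: germ0.
Qed.

Program Definition shN (a : shsec U) : shsec U :=
  @ShSec U (fun x => - shfun a x) _.
Next Obligation.
move=> a x; have [V [H [s [Vx aE]]]] := shloc a x.
by exists V, H, (- s); split => // y; rewrite aE -germN.
Qed.

Program Definition shD (a b : shsec U) : shsec U :=
  @ShSec U (fun x => shfun a x + shfun b x) _.
Next Obligation.
move=> a b x; have [V [H [s [Vx aE]]]] := shloc a x.
have [V' [H' [s' [V'x bE]]]] := shloc b x.
exists (oI V V'), (subset_trans (@oI_l _ V V') H).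
exists (mres (@oI_l _ V V') s + mres (@oI_r _ V V') s'); split => // y.
rewrite -germD (germ_mres _ (oI_l (proj2_sig y))) (germ_mres _ (oI_r (proj2_sig y))).
have -> : germ (oI_l (proj2_sig y)) s = shfun a (incl H (incl (@oI_l _ V V') y)).
  exact: esym (aE (incl (@oI_l _ V V') y)).
have -> : germ (oI_r (proj2_sig y)) s' = shfun b (incl H' (incl (@oI_r _ V V') y)).
  exact: esym (bE (incl (@oI_r _ V V') y)).
exact: (f_equal2 (@stalkD (sval y)) (shfun_irr _ _ _) (shfun_irr _ _ _)).
Qed.

Program Definition shZ (f : O U) (a : shsec U) : shsec U :=
  @ShSec U (fun x => stalkZ (proj2_sig x) f (shfun a x)) _.
Next Obligation.
move=> f a x; have [V [H [s [Vx aE]]]] := shloc a x.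
exists V, H, (ores H f *: s); split => // y.
by rewrite aE; exact: germZ.
Qed.

HB.instance Definition _ := gen_eqMixin (shsec U).
HB.instance Definition _ := gen_choiceMixin (shsec U).

Fact shDA : associative shD.
Proof. by move=> a b c; apply: shsec_ext => x /=; rewrite addrA. Qed.
Fact shDC : commutative shD.
Proof. by move=> a b; apply: shsec_ext => x /=; rewrite addrC. Qed.
Fact sh0D : left_id sh0 shD.
Proof. by move=> a; apply: shsec_ext => x /=; rewrite add0r. Qed.
Fact shND : left_inverse sh0 shN shD.
Proof. by move=> a; apply: shsec_ext => x /=; rewrite addNr. Qed.

HB.instance Definition _ :=
  GRing.isZmodule.Build (shsec U) shDA shDC sh0D shND.

Fact shZA f g a : shZ f (shZ g a) = shZ (f * g) a.
Proof. by apply: shsec_ext => x /=; rewrite stalkZA. Qed.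
Fact sh1Z : left_id 1 shZ.
Proof. by move=> a; apply: shsec_ext => x /=; rewrite stalk1Z. Qed.
Fact shZDr : right_distributive shZ +%R.
Proof. by move=> f a b; apply: shsec_ext => x /=; rewrite stalkZDr. Qed.
Fact shZDl a : {morph shZ^~ a : f g / f + g}.
Proof. by move=> f g; apply: shsec_ext => x /=; rewrite stalkZDl. Qed.

HB.instance Definition _ :=
  GRing.Zmodule_isLmodule.Build (O U) (shsec U) shZA sh1Z shZDr shZDl.

End Ops.

Program Definition sh_res (U V : openset X) (H : V `<=` U) (a : shsec U) :
  shsec V := @ShSec V (fun x => shfun a (incl H x)) _.
Next Obligation.
move=> U V H a x; have [W [HW [s [Wx aE]]]] := shloc a (incl H x).
exists (oI V W), (@oI_l _ V W), (mres (@oI_r _ V W) s); split.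
  by split; [exact: proj2_sig|].
move=> y; rewrite (germ_mres _ (oI_r (proj2_sig y))).
have -> : germ (oI_r (proj2_sig y)) s = shfun a (incl HW (incl (@oI_r _ V W) y)).
  exact: esym (aE (incl (@oI_r _ V W) y)).
Show.
exact: (@shfun_irr U a (sval y)).
Qed.

Program Definition sheafify : omodule X :=
  @OModule R X (fun U => shsec U) sh_res _ _ _ _.
Next Obligation. by move=> U V H a b; exact: shsec_ext. Qed.
Next Obligation.
move=> U V H f a; apply: shsec_ext => x /=.
have [W [HW [Wx [s [_ [_ [-> _ _]]]]]]] :=
  stalk_common (proj2_sig x) (shfun a (incl H x)) 0 0.
rewrite (germZ (proj2_sig x) HW) (germZ _ (subset_trans HW H)).
by rewrite (ores_comp _ _ (subset_trans HW H)).
Qed.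
Next Obligation.
move=> U H a; apply: shsec_ext => -[x Ux] /=; exact: shfun_irr.
Qed.
Next Obligation.
move=> U V W HVU HWV HWU a; apply: shsec_ext => -[x Ux] /=; exact: shfun_irr.
Qed.

End Sheafification.

Definition tensor (R : realType) (X : fspace R) (M N : omodule X) : omodule X :=
  sheafify (ptensor M N).

Section Conjugation.
Variables (R : realType) (X : fspace R) (U : openset X).

Lemma gfunE (g : G2 U) (V : openset X) (H : V `<=` U) (p : dual (O V)) :
  gfun g H p =
  (p.1, (gfun g H (p.1, 0)).2 + ores H (uval (xi2 g)) * p.2).
Proof.
have tE : gfun g H (0, 1) = (0, ores H (uval (xi2 g))).
  have := gfun_res g (@subset_refl _ U) H H (0, 1).
  rewrite /dual_res /= ores0 ores1 => <-.
  by rewrite gfun_mod ores0.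
have pE : p = ((p.1, 0) : dual (O V)) + ((p.2, 0) : dual (O V)) * (0, 1).
  rewrite [LHS]surjective_pairing [in RHS]/GRing.mul /= /dual_mul /=.
  rewrite [RHS]/GRing.add /= /add_pair /=.
  by rewrite !mulr0 mulr1 addr0 addr0 add0r.
rewrite [RHS]surjective_pairing /= {1}pE gfunD gfunM tE.
rewrite [LHS]surjective_pairing /= !gfun_mod /= mulr0 addr0.
by rewrite mulr0 addr0 mulrC.
Qed.

Lemma unit_actP (u : ounit U) (D D' : der U) :
  unit_act u D D' <-> D' = uval u *: D.
Proof.
have conjE (g : G2 U) : (g * iota D)%g = (iota (uval (xi2 g) *: D) * g)%g.
  apply: G2_ext => V H p /=.
  rewrite [LHS]gfunE [in RHS](gfunE g) /=.
  by congr pair; rewrite mulrDr addrCA.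
have iota_inj (E E' : der U) : iota E = iota E' -> E = E'.
  move=> EE'; apply: der_ext => V H f.
  have := congr1 (fun g : G2 U => (gfun g H (f, 0)).2) EE'.
  by rewrite /= !addr0.
split=> [[g [<- e]]|->].
  by apply: iota_inj; rewrite e conjE mulgK.
exists (diag u).
have xu : xi2 (diag u) = u.
  by apply: ounit_ext; rewrite /= ores_id mulr1.
by split => //; rewrite conjE xu mulgK.
Qed.

Lemma unit_actD (u : ounit U) (D D' E E' : der U) :
  unit_act u D D' -> unit_act u E E' -> unit_act u (D + E) (D' + E').
Proof. by move=> /unit_actP-> /unit_actP->; apply/unit_actP; rewrite scalerDr. Qed.

Lemma unit_actN (u : ounit U) (D D' : der U) :
  unit_act u D D' -> unit_act u (- D) (- D').
Proof. by move=> /unit_actP->; apply/unit_actP; rewrite scalerN. Qed.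

Lemma unit_act0 (u : ounit U) : unit_act u 0 0.
Proof. by apply/unit_actP; rewrite scaler0. Qed.

Lemma unit_actZ (u : ounit U) (f : O U) (D D' : der U) :
  unit_act u D D' -> unit_act u (f *: D) (f *: D').
Proof.
by move=> /unit_actP->; apply/unit_actP; rewrite !scalerA mulrC.
Qed.

End Conjugation.

Section Cech.
Variables (R : realType) (X : fspace R).
Local Notation C := R[i].

Record ocover := OCover {
  cidx : Type;
  cset :> cidx -> openset X;
  cset_cover : forall x : X, exists i, cset i x
}.

(* Cech 1-cocycles of O_X^*; the cocycle condition is imposed on every open W *)
(* on which the three terms make sense.                                       *)
Record ucocycle (U : ocover) := UCocycle {
  uco :> forall i j : cidx U, ounit (oI (U i) (U j));
  uco_mul : forall (i j k : cidx U) (W : openset X)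
    (Wij : W `<=` oI (U i) (U j)) (Wjk : W `<=` oI (U j) (U k))
    (Wik : W `<=` oI (U i) (U k)),
    (unit_res Wij (uco i j) * unit_res Wjk (uco j k))%g = unit_res Wik (uco i k)
}.

(* Equality of the classes in H^1(X, O_X^* ). *)
Definition ucohomologous (U V : ocover) (a : ucocycle U) (b : ucocycle V) :
    Prop :=
  exists (W : ocover) (s : cidx W -> cidx U) (t : cidx W -> cidx V)
    (Hs : forall k, W k `<=` U (s k)) (Ht : forall k, W k `<=` V (t k))
    (u : forall k, ounit (W k)),
  forall k l : cidx W,
    (unit_res (oIS (Hs k) (Hs l)) (a (s k) (s l)) *
       unit_res (@oI_r _ (W k) (W l)) (u l))%g =
    (unit_res (@oI_l _ (W k) (W l)) (u k) *
       unit_res (oIS (Ht k) (Ht l)) (b (t k) (t l)))%g.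

(* e trivializes M over V: f |-> f e is an isomorphism from O_V to M_V. *)
Definition frame (M : omodule X) (V : openset X) (e : M V) : Prop :=
  forall (W : openset X) (H : W `<=` V),
    bijective (fun f : O W => f *: mres H e).

Definition line_bundle (L : omodule X) : Prop :=
  is_sheaf L /\
  exists (V : ocover) (e : forall a, L (V a)), forall a, frame (e a).

(* a represents the class of L in H^1(X, O_X^* ).  For frames (e_i), the      *)
(* cocycle (b_ij) of L is given by e_j = b_ij e_i, so that the sections of L  *)
(* are the families (s_i) such that s_i = b_ij s_j.                           *)
Definition represents_class (L : omodule X) (U : ocover) (a : ucocycle U) :
    Prop :=
  exists (V : ocover) (e : forall i, L (V i)) (b : ucocycle V),
    [/\ forall i, frame (e i),
        forall i j, mres (@oI_r _ (V i) (V j)) (e j) =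
                    uval (b i j) *: mres (@oI_l _ (V i) (V j)) (e i) &
        ucohomologous b a].

(* Cech 1-cocycles of a sheaf of O_X-modules. *)
Record cocycle_on (F : omodule X) (V : ocover) := CocycleOn {
  coc :> forall i j : cidx V, F (oI (V i) (V j));
  coc_add : forall (i j k : cidx V) (W : openset X)
    (Wij : W `<=` oI (V i) (V j)) (Wjk : W `<=` oI (V j) (V k))
    (Wik : W `<=` oI (V i) (V k)),
    mres Wij (coc i j) + mres Wjk (coc j k) = mres Wik (coc i k)
}.

Record cocycle (F : omodule X) := Cocycle {
  coc_cover : ocover;
  coc_val :> cocycle_on F coc_cover
}.

Definition cohomologous (F : omodule X) (c d : cocycle F) : Prop :=
  exists (W : ocover) (s : cidx W -> cidx (coc_cover c))
    (t : cidx W -> cidx (coc_cover d))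
    (Hs : forall k, W k `<=` coc_cover c (s k))
    (Ht : forall k, W k `<=` coc_cover d (t k))
    (b : forall k, F (W k)),
  forall k l : cidx W,
    mres (oIS (Hs k) (Hs l)) (coc_val c (s k) (s l)) -
    mres (oIS (Ht k) (Ht l)) (coc_val d (t k) (t l)) =
    mres (@oI_l _ (W k) (W l)) (b k) - mres (@oI_r _ (W k) (W l)) (b l).

Lemma cohomologous_refl (F : omodule X) (c : cocycle F) : cohomologous c c.
Proof.
exists (coc_cover c), id, id, (fun k => @subset_refl _ _),
  (fun k => @subset_refl _ _), (fun k => 0) => k l.
by rewrite subrr !mres0 subrr.
Qed.

Lemma cohomologous_sym (F : omodule X) (c d : cocycle F) :
  cohomologous c d -> cohomologous d c.
Proof.
move=> [W [s [t [Hs [Ht [b E]]]]]].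
exists W, t, s, Ht, Hs, (fun k => - b k) => k l.
by rewrite !mresN -opprD -E opprB.
Qed.

Lemma cohomologous_trans (F : omodule X) (c d e : cocycle F) :
  cohomologous c d -> cohomologous d e -> cohomologous c e.
Proof.
case: c d e => [U c] [V d] [V' e] /=.
move=> [W [s [t [Hs [Ht [b E]]]]]] [W' [s' [t' [Hs' [Ht' [b' E']]]]]].
move: s t s' t' Hs Ht Hs' Ht' E E' => /= s t s' t' Hs Ht Hs' Ht' E E'.
have Zcov x : exists p : cidx W * cidx W', oI (W p.1) (W' p.2) x.
  have [k Wx] := cset_cover W x; have [k' W'x] := cset_cover W' x.
  by exists (k, k').
pose Z := OCover Zcov.
pose Zl p : Z p `<=` W p.1 := @oI_l _ (W p.1) (W' p.2).
pose Zr p : Z p `<=` W' p.2 := @oI_r _ (W p.1) (W' p.2).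
pose Zd p : Z p `<=` oI (V (t p.1)) (V (s' p.2)) := oIS (@Ht p.1) (@Hs' p.2).
exists Z, (fun p => s p.1), (fun p => t' p.2).
exists (fun p => subset_trans (Zl p) (@Hs p.1)).
exists (fun p => subset_trans (Zr p) (@Ht' p.2)).
exists (fun p => mres (Zl p) (b p.1) + mres (Zd p) (d (t p.1) (s' p.2)) +
                 mres (Zr p) (b' p.2)) => p q /=.
pose Y := oI (Z p) (Z q).
pose Yl : Y `<=` oI (W p.1) (W q.1) := oIS (Zl p) (Zl q).
pose Yr : Y `<=` oI (W' p.2) (W' q.2) := oIS (Zr p) (Zr q).
pose Ytt : Y `<=` oI (V (t p.1)) (V (t q.1)) :=
  subset_trans Yl (oIS (@Ht p.1) (@Ht q.1)).
pose Yss : Y `<=` oI (V (s' p.2)) (V (s' q.2)) :=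
  subset_trans Yr (oIS (@Hs' p.2) (@Hs' q.2)).
pose Yp : Y `<=` oI (V (t p.1)) (V (s' p.2)) :=
  subset_trans (@oI_l _ (Z p) (Z q)) (Zd p).
pose Yq : Y `<=` oI (V (t q.1)) (V (s' q.2)) :=
  subset_trans (@oI_r _ (Z p) (Z q)) (Zd q).
have Yts : Y `<=` oI (V (t p.1)) (V (s' q.2)).
  by move=> x Yx; split; [exact: (Ytt x Yx).1|exact: (Yss x Yx).2].
have d1 := coc_add d Ytt Yq Yts; have d2 := coc_add d Yp Yss Yts.
have {}E := congr1 (mres Yl) (E p.1 q.1).
have {}E' := congr1 (mres Yr) (E' p.2 q.2).
pose Pl := @oI_l _ (Z p) (Z q); pose Pr := @oI_r _ (Z p) (Z q).
pose Yb1 := subset_trans Yl (@oI_l _ (W p.1) (W q.1)).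
pose Yb2 := subset_trans Yl (@oI_r _ (W p.1) (W q.1)).
pose Yb3 := subset_trans Yr (@oI_l _ (W' p.2) (W' q.2)).
pose Yb4 := subset_trans Yr (@oI_r _ (W' p.2) (W' q.2)).
pose Yc := oIS (subset_trans (Zl p) (@Hs p.1)) (subset_trans (Zl q) (@Hs q.1)).
pose Ye := oIS (subset_trans (Zr p) (@Ht' p.2))
  (subset_trans (Zr q) (@Ht' q.2)).
move: E E'; rewrite -/Pl -/Pr -/Yc -/Ye !mresD !mresN.
rewrite (mres_comp _ Yl Yc) (mres_comp _ Yl Ytt) (mres_comp _ Yl Yb1).
rewrite (mres_comp _ Yl Yb2) (mres_comp _ Yr Yss) (mres_comp _ Yr Ye).
rewrite (mres_comp _ Yr Yb3) (mres_comp _ Yr Yb4).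
rewrite (mres_comp _ Pl Yb1) (mres_comp _ Pl Yp) (mres_comp _ Pl Yb3).
rewrite (mres_comp _ Pr Yb2) (mres_comp _ Pr Yq) (mres_comp _ Pr Yb4).
move: d1 d2 => d1 d2 /eqP E1 /eqP E2.
move: E1 E2; rewrite !subr_eq => /eqP-> /eqP E2.
apply/eqP; rewrite subr_eq; apply/eqP.
have -> : mres Ytt (d (t p.1) (t q.1)) =
    mres Yp (d (t p.1) (s' p.2)) + mres Yss (d (s' p.2) (s' q.2)) -
    mres Yq (d (t q.1) (s' q.2)).
  by rewrite d2 -d1 addrK.
rewrite E2.
set A1 := mres Yb1 _; set A2 := mres Yb2 _; set A3 := mres Yb3 _.
set A4 := mres Yb4 _; set A5 := mres Yp _; set A6 := mres Yq _.
set A7 := mres Ye _; rewrite !opprD !addrA.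
by rewrite [LHS](ACl (1*3*4*2*7*5*6))%AC.
Qed.

(* H^1(X, F), the colimit of the Cech H^1 over the open covers: classes of    *)
(* cocycles for the equivalence relation [cohomologous].                      *)
Definition H1 (F : omodule X) : Type :=
  {A : cocycle F -> Prop | exists c, A = cohomologous c}.

Definition h1_class (F : omodule X) (V : ocover) (c : cocycle_on F V) : H1 F :=
  exist _ (cohomologous (Cocycle c)) (ex_intro _ (Cocycle c) erefl).

Lemma h1P (F : omodule X) (V W : ocover) (c : cocycle_on F V)
  (d : cocycle_on F W) :
  h1_class c = h1_class d <-> cohomologous (Cocycle c) (Cocycle d).
Proof.
split=> [/(congr1 sval) /= ->|cd]; first exact: cohomologous_refl.
apply: eq_exist; apply: funext => e; apply/propext; split.
  by apply: cohomologous_trans; exact: cohomologous_sym.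
exact: cohomologous_trans.
Qed.

Definition h1_repr (F : omodule X) (A : H1 F) : cocycle F :=
  sval (cid (proj2_sig A)).

Program Definition cocycleZ (F : omodule X) (V : ocover) (a : C)
  (c : cocycle_on F V) : cocycle_on F V :=
  @CocycleOn F V (fun i j => ocst _ a *: c i j) _.
Next Obligation.
move=> F V a c i j k W Wij Wjk Wik; rewrite !mresZ !ores_cst -scalerDr.
by rewrite (coc_add c Wij Wjk Wik).
Qed.

Program Definition cocycle_map (F G : omodule X) (phi : omod_hom F G)
  (V : ocover) (c : cocycle_on F V) : cocycle_on G V :=
  @CocycleOn G V (fun i j => phi _ (c i j)) _.
Next Obligation.
move=> F G phi V c i j k W Wij Wjk Wik; rewrite -!hmap_res -linearD.
by rewrite (coc_add c Wij Wjk Wik).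
Qed.

(* Multiplication by a complex number on H^1(X, F); the class obtained does   *)
(* not depend on the representative, nor does that of h1_map below.           *)
Definition h1Z (F : omodule X) (a : C) (A : H1 F) : H1 F :=
  h1_class (cocycleZ a (h1_repr A)).

(* The map H^1(X, F) -> H^1(X, G) induced by phi. *)
Definition h1_map (F G : omodule X) (phi : omod_hom F G) (A : H1 F) : H1 G :=
  h1_class (cocycle_map phi (h1_repr A)).

End Cech.

Section Twist.
Variables (R : realType) (X : fspace R) (U : ocover X) (a : ucocycle U).

(* Sections of T_X^{g_1} over V: families (gamma_i), gamma_i in               *)
(* T_X(V /\ U_i), such that gamma_i = a_ij.gamma_j on V /\ U_i /\ U_j.         *)
Record twsec (V : openset X) := TwSec {
  twfun :> forall i : cidx U, der (oI V (U i));
  tw_act : forall (i j : cidx U) (W : openset X)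
    (Wi : W `<=` oI V (U i)) (Wj : W `<=` oI V (U j))
    (Wij : W `<=` oI (U i) (U j)),
    unit_act (unit_res Wij (a i j)) (der_res Wj (twfun j))
      (der_res Wi (twfun i))
}.

Lemma twsec_ext V (g h : twsec V) : (forall i, g i = h i) -> g = h.
Proof.
case: g h => g gP [h hP] /= gh.
have {}gh : g = h by exact: functional_extensionality_dep.
by case: _ / gh in hP *; congr TwSec; exact: Prop_irrelevance.
Qed.

Let resD (V W : openset X) (H : W `<=` V) (D E : der V) :
  der_res H (D + E) = der_res H D + der_res H E := mresD (o := tangent X) H D E.
Let resN (V W : openset X) (H : W `<=` V) (D : der V) :
  der_res H (- D) = - der_res H D := @mresN R X (tangent X) V W H D.
Let res0 (V W : openset X) (H : W `<=` V) :
  der_res H (0 : der V) = 0 := @mres0 R X (tangent X) V W H.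
Let resZ (V W : openset X) (H : W `<=` V) f (D : der V) :
  der_res H (f *: D) = ores H f *: der_res H D := mresZ (o := tangent X) H f D.
Let res_comp (V W Z : openset X) (HVW : W `<=` V) (HWZ : Z `<=` W)
  (HVZ : Z `<=` V) (D : der V) :
  der_res HWZ (der_res HVW D) = der_res HVZ D :=
  mres_comp (o := tangent X) HVW HWZ HVZ D.
Let res_id (V : openset X) (H : V `<=` V) (D : der V) : der_res H D = D :=
  mres_id (o := tangent X) H D.

Section Ops.
Variable V : openset X.

Program Definition tw0 : twsec V := @TwSec V (fun i => 0) _.
Next Obligation.
by move=> i j W Wi Wj Wij /=; rewrite !res0; exact: unit_act0.
Qed.

Program Definition twN (g : twsec V) : twsec V := @TwSec V (fun i => - g i) _.
Next Obligation.
by move=> g i j W Wi Wj Wij /=; rewrite !resN; apply: unit_actN; exact: tw_act.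
Qed.

Program Definition twD (g h : twsec V) : twsec V :=
  @TwSec V (fun i => g i + h i) _.
Next Obligation.
by move=> g h i j W Wi Wj Wij /=; rewrite !resD; apply: unit_actD; exact: tw_act.
Qed.

Program Definition twZ (f : O V) (g : twsec V) : twsec V :=
  @TwSec V (fun i => ores (@oI_l _ V (U i)) f *: g i) _.
Next Obligation.
move=> f g i j W Wi Wj Wij /=.
rewrite !resZ !(ores_comp _ _ (subset_trans Wi (@oI_l _ V (U i)))).
by apply: unit_actZ; exact: tw_act.
Qed.

HB.instance Definition _ := gen_eqMixin (twsec V).
HB.instance Definition _ := gen_choiceMixin (twsec V).

Fact twDA : associative twD.
Proof. by move=> f g h; apply: twsec_ext => i /=; rewrite addrA. Qed.
Fact twDC : commutative twD.
Proof. by move=> f g; apply: twsec_ext => i /=; rewrite addrC. Qed.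
Fact tw0D : left_id tw0 twD.
Proof. by move=> f; apply: twsec_ext => i /=; rewrite add0r. Qed.
Fact twND : left_inverse tw0 twN twD.
Proof. by move=> f; apply: twsec_ext => i /=; rewrite addNr. Qed.

HB.instance Definition _ :=
  GRing.isZmodule.Build (twsec V) twDA twDC tw0D twND.

Fact twZA f g (s : twsec V) : twZ f (twZ g s) = twZ (f * g) s.
Proof. by apply: twsec_ext => i /=; rewrite oresM scalerA. Qed.
Fact tw1Z : left_id 1 twZ.
Proof. by move=> s; apply: twsec_ext => i /=; rewrite ores1 scale1r. Qed.
Fact twZDr : right_distributive twZ +%R.
Proof. by move=> f s t; apply: twsec_ext => i /=; rewrite scalerDr. Qed.
Fact twZDl s : {morph twZ^~ s : f g / f + g}.
Proof. by move=> f g; apply: twsec_ext => i /=; rewrite oresD scalerDl. Qed.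

HB.instance Definition _ :=
  GRing.Zmodule_isLmodule.Build (O V) (twsec V) twZA tw1Z twZDr twZDl.

End Ops.

Program Definition tw_res (V W : openset X) (H : W `<=` V) (g : twsec V) :
  twsec W :=
  @TwSec W (fun i => der_res (oIS H (@subset_refl _ (U i))) (g i)) _.
Next Obligation.
move=> V W H g i j Z Zi Zj Zij /=.
have Ri := oIS H (@subset_refl _ (U i)); have Rj := oIS H (@subset_refl _ (U j)).
rewrite (res_comp _ _ (subset_trans Zi Ri)) (res_comp _ _ (subset_trans Zj Rj)).
exact: tw_act.
Qed.

(* T_X^{g_1} *)
Program Definition twist : omodule X :=
  @OModule R X (fun V => twsec V) tw_res _ _ _ _.
Next Obligation.
by move=> V W H g h; apply: twsec_ext => i /=; exact: resD.
Qed.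
Next Obligation.
move=> V W H f g; apply: twsec_ext => i /=; rewrite [LHS]resZ; congr (_ *: _).
have HW : oI W (U i) `<=` V := subset_trans (@oI_l _ W (U i)) H.
by rewrite (ores_comp _ _ HW) (ores_comp _ _ HW).
Qed.
Next Obligation.
by move=> V H g; apply: twsec_ext => i /=; exact: res_id.
Qed.
Next Obligation.
by move=> V W Z HVW HWZ HVZ g; apply: twsec_ext => i /=; exact: res_comp.
Qed.

Program Definition G2_res (V W : openset X) (H : W `<=` V) (g : G2 V) : G2 W :=
  @MkG2 R X W (fun Z HZ p => gfun g (subset_trans HZ H) p)
    (fun Z HZ p => ginv g (subset_trans HZ H) p) _ _ _ _ _ _ _.
Next Obligation. by move=> V W H g Z HZ; exact: gfunK. Qed.
Next Obligation. by move=> V W H g Z HZ; exact: ginvK. Qed.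
Next Obligation. by move=> V W H g Z HZ; exact: gfunD. Qed.
Next Obligation. by move=> V W H g Z HZ; exact: gfunM. Qed.
Next Obligation. by move=> V W H g Z HZ; exact: gfun_cst. Qed.
Next Obligation. by move=> V W H g Z HZ; exact: gfun_mod. Qed.
Next Obligation. by move=> V W H g Z Z' HZ HZ' HZZ' p; exact: gfun_res. Qed.

(* For V contained in U_i, T_X^{g_1} is identified with T_X on V by           *)
(* (gamma_j) |-> gamma_i.                                                     *)
Definition tw_comp (i : cidx U) (V : openset X) (H : V `<=` U i)
    (g : twist V) : der V :=
  der_res (oI_sub (@subset_refl _ V) H) (twfun g i).

(* gamma' = h.gamma for the action of H^0(X, O_X^* ) on H^1(X, T_X^{g_1}):    *)
(* gamma is represented by (gamma_kl), gamma_kl in T_X(V_kl), on a cover (V_k)*)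
(* refining (U_i) and such that h lifts to h_k in G_2(V_k), and gamma' by     *)
(* (h_k gamma_kl g_kl h_l^-1 g_kl^-1), where g_kl is f |-> f, t |-> a_kl t.   *)
Definition H0_act (h : ounit (@oT X)) (gamma gamma' : H1 twist) : Prop :=
  exists (V : ocover X) (s : cidx V -> cidx U) (Hs : forall k, V k `<=` U (s k))
    (hl : forall k, G2 (V k)) (c c' : cocycle_on twist V),
  [/\ forall k, xi2 (hl k) = unit_res (@oT_sub _ (V k)) h,
      gamma = h1_class c,
      gamma' = h1_class c' &
      forall k l,
        let Hkl := subset_trans (@oI_l _ (V k) (V l)) (Hs k) in
        let gkl := diag (unit_res (oIS (Hs k) (Hs l)) (a (s k) (s l))) in
        iota (tw_comp Hkl (c' k l)) =
        (G2_res (@oI_l _ (V k) (V l)) (hl k) * iota (tw_comp Hkl (c k l)) * gkl *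
         (G2_res (@oI_r _ (V k) (V l)) (hl l))^-1 * gkl^-1)%g].

End Twist.

(* Main.v *)
(* If e_i are local frames of L with e_j = a_ij e_i, a section (gamma_i) of   *)
(* the twisted sheaf is sent to the section of T_X (x) L given locally by     *)
(* gamma_i (x) e_i; this does not depend on i because gamma_i = a_ij gamma_j, *)
(* and each D |-> D (x) e_i is bijective.                                     *)
(*   A lift of the constant c to G_2(V_k) is iota(D_k) diag(c) for some       *)
(* derivation D_k.  Moving the diagonal factors to the right,                 *)
(*   h_k gamma_kl g_kl h_l^-1 g_kl^-1 = iota(D_k + c gamma_kl - a_kl D_l),    *)
(* and D_k - a_kl D_l is the coboundary of (D_k) in the twisted sheaf, whence *)
(* the class c gamma.                                                         *)
Require Import Defs.
From HB Require Import structures.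
From mathcomp Require Import all_boot all_order all_algebra.
From mathcomp Require Import complex.
From mathcomp Require Import boolp classical_sets functions reals topology.

Set Implicit Arguments.
Unset Strict Implicit.
Unset Printing Implicit Defensive.

Import GRing.Theory.
Local Open Scope classical_set_scope.
Local Open Scope complex_scope.
Local Open Scope ring_scope.
Local Open Scope quotient_scope.

(** Conjugation by an element of [G2] over a unit u multiplies derivations by u ([unit_actP]). A
    twisted section is thus a family with gamma_k = a_kl gamma_l, while the frames of
    [adapted_frames] satisfy e_l = a_kl e_k, so gamma_k (x) e_k does not depend on k
    ([twist_pure_indep]). Tensoring with a free module of rank one loses nothing ([tpure_inj],
    [tpure_surj]), so the resulting map is injective and locally surjective. Since derivations glue,
    and hence twisted sections do ([tangent_sheaf], [twist_sheaf]), it is an isomorphism by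
    [omod_iso_local].

    For the action, every element of [G2] is a derivation part times a diagonal part ([G2_decomp]).
    By [twisted_conj], lifts of the constant c with derivation parts D_k turn gamma_kl into c
    gamma_kl + D_k - a_kl D_l. The last two terms are the coboundary of the twisted sections
    extending the D_k ([tw_extend]), so the class is c gamma; lifts with D_k = 0 give the converse
    ([H0_act_h1Z]). An isomorphism of modules induces an injective map on H^1 commuting with scalars
    ([h1_map_inj], [h1_mapZ]), which carries the result over to T_X (x) L. *)

(** * Tensor product with a free module of rank one *)

Section PureTensors.
Variables (A : comPzRingType) (M N : lmodType A).

Definition tpure (m : M) (n : N) : tens M N := \pi_(tens M N) [:: (m, n)].

Lemma tpureDl m m' n : tpure (m + m') n = tpure m n + tpure m' n.
Proof. by rewrite [RHS]tensDE; apply/tensP; exact: tens_addl. Qed.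

Lemma tpureZl c m n : tpure (c *: m) n = c *: tpure m n.
Proof. by rewrite [RHS]tensZE. Qed.

Lemma tpureZr c m n : tpure m (c *: n) = c *: tpure m n.
Proof. by rewrite -tpureZl; apply/tensP; apply: tens_sym; exact: tens_bal. Qed.

Section Free.
Variable e : N.
Hypothesis e_bij : bijective (fun f : A => f *: e).

(** Every n is a multiple of [e]; moving the scalar to the left factor collapses a formal sum to one
    term. *)
Lemma tpure_surj (x : tens M N) : exists m, x = tpure m e.
Proof.
have [g _ gK] := e_bij.
elim/quotW: x => s; elim: s => [|[m n] s [m' IHs]].
  by exists 0; apply/tensP; apply: tens_sym; exact: tens_zero.
exists (g n *: m + m'); rewrite tpureDl -IHs tpureZl -tpureZr gK.
by rewrite [RHS]tensDE.
Qed.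

(** The contraction sending (m, n) to g(n) m, with [g] the coordinate along [e], respects each
    generator of [tens_eq] and recovers m from its tensor with [e]. *)
Lemma tpure_inj : injective (fun m => tpure m e).
Proof.
have [g fK gK] := e_bij.
have gD n n' : g (n + n') = g n + g n'.
  by apply: (can_inj fK); rewrite scalerDl !gK.
have gZ c n : g (c *: n) = c * g n.
  by apply: (can_inj fK); rewrite -scalerA !gK.
have g1 : g e *: e = 1 *: e by rewrite gK scale1r.
pose contr (s : seq (M * N)) := \sum_(p <- s) g p.2 *: p.1.
have contr_eq s t : tens_eq s t -> contr s = contr t.
  rewrite /contr; elim=> {s t} //.
  - by move=> s t u _ -> _ ->.
  - by move=> s s' t t' _ IHs _ IHt; rewrite !big_cat /= IHs IHt.
  - by move=> s t; rewrite !big_cat /= addrC.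
  - by move=> n; rewrite big_nil big_seq1 scaler0.
  - by move=> m m' n; rewrite !big_cons !big_nil !addr0 scalerDr.
  - by move=> m n n'; rewrite !big_cons !big_nil !addr0 gD scalerDl.
  - by move=> c m n; rewrite !big_seq1 /= gZ scalerA mulrC.
move=> m m' /tensP/contr_eq; rewrite /contr !big_seq1 /=.
by rewrite (can_inj fK g1) !scale1r.
Qed.

End Free.
End PureTensors.

Lemma tpure_res (R : realType) (X : fspace R) (M N : omodule X)
    (U V : openset X) (H : V `<=` U) (m : M U) (n : N U) :
  mres (o := ptensor M N) H (tpure m n) = tpure (mres H m) (mres H n).
Proof. exact: ptens_resE. Qed.

(** * Gluing of regular functions and of derivations *)

Section TangentSheaf.
Variables (R : realType) (X : fspace R).

Lemma rfun_irr (U : openset X) (f : O U) x (p q : U x) :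
  f (exist _ x p) = f (exist _ x q).
Proof. by rewrite (Prop_irrelevance p q). Qed.

Lemma ores_sep (U : openset X) (I : Type) (V : I -> openset X)
    (HV : forall i, V i `<=` U) (covU : forall x, U x -> exists i, V i x)
    (f g : O U) :
  (forall i, ores (HV i) f = ores (HV i) g) -> f = g.
Proof.
move=> fg; apply: val_inj; apply: funext => -[x Ux] /=.
have [i Vix] := covU x Ux.
have E := congr1 (fun h : O (V i) => h (exist _ x Vix)) (fg i).
by rewrite (rfun_irr f _ (HV i x Vix)) (rfun_irr g _ (HV i x Vix)); exact: E.
Qed.

Lemma ores_glue (U : openset X) (I : Type) (V : I -> openset X)
    (HV : forall i, V i `<=` U) (covU : forall x, U x -> exists i, V i x)
    (s : forall i, O (V i)) :
  (forall i j (W : openset X) (Wi : W `<=` V i) (Wj : W `<=` V j),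
    ores Wi (s i) = ores Wj (s j)) ->
  exists t : O U, forall i, ores (HV i) t = s i.
Proof.
move=> sE.
have sEx i j x (Vix : V i x) (Vjx : V j x) :
    s i (exist _ x Vix) = s j (exist _ x Vjx).
  have E := congr1
    (fun h : O (oI (V i) (V j)) => h (exist _ x (conj Vix Vjx)))
    (sE i j _ (@oI_l _ (V i) (V j)) (@oI_r _ (V i) (V j))).
  rewrite (rfun_irr _ _ (@oI_l _ (V i) (V j) x (conj Vix Vjx))).
  rewrite (rfun_irr (s j) _ (@oI_r _ (V i) (V j) x (conj Vix Vjx))).
  exact: E.
(* The value at x is read in an arbitrary member of the cover containing x; [sEx] makes the choice
   immaterial. *)
pose ix (x : pts U) := cid (covU _ (proj2_sig x)).
pose t (x : pts U) : R[i] := s (sval (ix x)) (exist _ (sval x) (svalP (ix x))).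
have tE i : t \o Defs.incl (HV i) = s i.
  by apply: funext => -[x Vix]; exact: sEx.
have rt : regular t.
  apply: regular_glue => -[x Ux]; have [i Vix] := covU x Ux.
  exists (V i), (HV i); split => //; rewrite tE.
  by apply/asboolP; exact: rfun_regular.
by exists (RegFun (asboolT rt)) => i; apply: val_inj; exact: tE.
Qed.

Lemma der_resD (V W : openset X) (H : W `<=` V) (D E : der V) :
  der_res H (D + E) = der_res H D + der_res H E.
Proof. exact: (mresD (o := tangent X)). Qed.

Lemma der_resB (V W : openset X) (H : W `<=` V) (D E : der V) :
  der_res H (D - E) = der_res H D - der_res H E.
Proof. exact: der_ext. Qed.

Lemma der_resZ (V W : openset X) (H : W `<=` V) f (D : der V) :
  der_res H (f *: D) = ores H f *: der_res H D.
Proof. exact: (mresZ (o := tangent X)). Qed.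

Lemma der_res_id (V : openset X) (H : V `<=` V) (D : der V) : der_res H D = D.
Proof. exact: (mres_id (o := tangent X)). Qed.

Lemma der_res_comp (V W Z : openset X) (HVW : W `<=` V) (HWZ : Z `<=` W)
    (HVZ : Z `<=` V) (D : der V) :
  der_res HWZ (der_res HVW D) = der_res HVZ D.
Proof. exact: (mres_comp (o := tangent X)). Qed.

Lemma dfun_irr (U V : openset X) (H H' : V `<=` U) (D : der U) f :
  dfun D H f = dfun D H' f.
Proof. by rewrite (Prop_irrelevance H H'). Qed.

(** An open Z need not lie in any V_i, so the two values at a function on Z are compared on the
    traces of the V_i, using compatibility with restriction. *)
Lemma der_sep (U : openset X) (I : Type) (V : I -> openset X)
    (HV : forall i, V i `<=` U) (covU : forall x, U x -> exists i, V i x)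
    (D E : der U) :
  (forall i, der_res (HV i) D = der_res (HV i) E) -> D = E.
Proof.
move=> DE; apply: der_ext => Z HZ f.
apply: (@ores_sep Z I (fun i => oI Z (V i)) (fun i => @oI_l _ Z (V i))).
  by move=> x Zx; have [i Vix] := covU x (HZ x Zx); exists i.
move=> i; rewrite !(dfun_res _ HZ (subset_trans (@oI_r _ Z (V i)) (HV i))).
exact: (congr1 (fun D0 : der (V i) =>
  dfun D0 (@oI_r _ Z (V i)) (ores (@oI_l _ Z (V i)) f)) (DE i)).
Qed.

(** The value of the glued derivation at f on Z is glued from s_i applied to f on the intersections
    of Z with the V_i. Its laws hold because they hold after restriction to these pieces. *)
Lemma tangent_sheaf : is_sheaf (tangent X).
Proof.
move=> U I V HV covU s sE.
have covZ (Z : openset X) (HZ : Z `<=` U) x :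
    Z x -> exists i, oI Z (V i) x.
  by move=> Zx; have [i Vix] := covU x (HZ x Zx); exists i.
pose Zl (Z : openset X) i := @oI_l _ Z (V i).
pose Zr (Z : openset X) i := @oI_r _ Z (V i).
have sE' i j (W : openset X) (Wi : W `<=` V i) (Wj : W `<=` V j) f :
    dfun (s i) Wi f = dfun (s j) Wj f.
  have := congr1 (fun D : der W => dfun D (@subset_refl _ W) f)
    (sE i j W Wi Wj).
  rewrite /= => E.
  rewrite (dfun_irr _ (subset_trans (@subset_refl _ W) Wi)) E.
  exact: dfun_irr.
have dP (Z : openset X) (HZ : Z `<=` U) (f : O Z) :
    exists g : O Z, forall i,
      ores (Zl Z i) g = dfun (s i) (Zr Z i) (ores (Zl Z i) f).
  apply: ores_glue; first exact: covZ.
  move=> i j W Wi Wj.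
  rewrite (dfun_res _ _ (subset_trans Wi (Zr Z i))).
  rewrite (dfun_res _ _ (subset_trans Wj (Zr Z j))).
  by rewrite !(ores_comp _ _ (subset_trans Wi (Zl Z i))); exact: sE'.
pose d Z HZ f := sval (cid (dP Z HZ f)).
have dE Z HZ f i :
    ores (Zl Z i) (d Z HZ f) = dfun (s i) (Zr Z i) (ores (Zl Z i) f).
  exact: svalP (cid (dP Z HZ f)) i.
have sep (Z : openset X) (HZ : Z `<=` U) := @ores_sep Z I _ (Zl Z) (covZ Z HZ).
have dD Z HZ : {morph d Z HZ : f g / f + g}.
  by move=> f g; apply: (sep _ HZ) => i; rewrite !oresD !dE oresD dfunD.
have dM Z HZ (f g : O Z) : d Z HZ (f * g) = f * d Z HZ g + g * d Z HZ f.
  by apply: (sep _ HZ) => i; rewrite oresD !oresM !dE oresM dfunM.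
have dC Z HZ c : d Z HZ (ocst Z c) = 0.
  by apply: (sep _ HZ) => i; rewrite dE ores0 ores_cst dfun_cst.
have dR (Z W : openset X) (HZ : Z `<=` U) (HW : W `<=` U) (HWZ : W `<=` Z)
    (f : O Z) : ores HWZ (d Z HZ f) = d W HW (ores HWZ f).
  apply: (sep _ HW) => i; rewrite dE.
  pose S := oIS HWZ (@subset_refl _ (V i)).
  rewrite (ores_comp _ _ (subset_trans S (Zl Z i))).
  rewrite -(ores_comp (Zl Z i) S) dE (dfun_res _ _ (Zr W i)).
  by rewrite (ores_comp _ S (subset_trans (Zl W i) HWZ))
    (ores_comp _ _ (subset_trans (Zl W i) HWZ)).
pose D := Der dD dM dC dR.
(* Even for Z inside V_i the glued value comes from the whole cover, so s_i and s_j have to be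
   compared on the intersection of Z and V_j. *)
have DE i : der_res (HV i) D = s i.
  apply: der_ext => Z HZ f /=.
  apply: (sep _ (subset_trans HZ (HV i))) => j; rewrite dE.
  by rewrite (dfun_res _ _ (subset_trans (Zl Z j) HZ)); exact: sE'.
exists D; split=> [//|E EE].
by apply: (@der_sep U I V HV covU) => i; rewrite DE [RHS]EE.
Qed.

End TangentSheaf.

(** * The twisted sheaf: gluing, and extension of one component *)

Section TwistSheaf.
Variables (R : realType) (X : fspace R) (U : ocover X) (a : ucocycle U).

Lemma tw_actE (V : openset X) (g : twsec a V) (i j : cidx U) (W : openset X)
    (Wi : W `<=` oI V (U i)) (Wj : W `<=` oI V (U j))
    (Wij : W `<=` oI (U i) (U j)) :
  der_res Wi (g i) = ores Wij (uval (a i j)) *: der_res Wj (g j).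
Proof. by have /unit_actP := tw_act g Wi Wj Wij. Qed.

(** Each component glues on its own in T_X; the transition relations between the glued components
    can be checked on the cover, where they are those of the given sections. *)
Lemma twist_sheaf : is_sheaf (twist a).
Proof.
move=> V I Z HZ covV s sE.
pose S i k := oIS (@HZ i) (@subset_refl _ (U k)).
have covk k x : oI V (U k) x -> exists i, oI (Z i) (U k) x.
  by move=> [Vx Ukx]; have [i Zix] := covV x Vx; exists i.
have glue k := @tangent_sheaf R X (oI V (U k)) I (fun i => oI (Z i) (U k))
  (fun i => S i k) (covk k) (fun i => twfun (s i) k).
have {glue} glue k : exists! D : der (oI V (U k)),
    forall i, der_res (S i k) D = twfun (s i) k.
  apply: glue => i j W Wi Wj.
  have WZi := subset_trans Wi (@oI_l _ (Z i) (U k)).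
  have WZj := subset_trans Wj (@oI_l _ (Z j) (U k)).
  have WU := subset_trans Wi (@oI_r _ (Z i) (U k)).
  have E := congr1 (fun g : twsec a W =>
    der_res (oI_sub (@subset_refl _ W) WU) (twfun g k)) (sE i j W WZi WZj).
  by move: E; rewrite /= (der_res_comp _ _ Wi) (der_res_comp _ _ Wj).
have act (D : forall k, der (oI V (U k)))
    (DE : forall k i, der_res (S i k) (D k) = twfun (s i) k) i j (W : openset X)
    (Wi : W `<=` oI V (U i)) (Wj : W `<=` oI V (U j))
    (Wij : W `<=` oI (U i) (U j)) :
    unit_act (unit_res Wij (a i j)) (der_res Wj (D j)) (der_res Wi (D i)).
  apply/unit_actP => /=.
  apply: (@der_sep _ _ _ _ (fun l => oI W (Z l)) (fun l => @oI_l _ W (Z l))).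
    by move=> x Wx; have [l Zlx] := covV x (Wi x Wx).1; exists l.
  move=> l; rewrite der_resZ.
  pose Y := oI W (Z l).
  have YW : Y `<=` W := @oI_l _ W (Z l).
  have YZ : Y `<=` Z l := @oI_r _ W (Z l).
  have Yi : Y `<=` oI (Z l) (U i).
    exact: oI_sub YZ (subset_trans YW (subset_trans Wi (@oI_r _ V (U i)))).
  have Yj : Y `<=` oI (Z l) (U j).
    exact: oI_sub YZ (subset_trans YW (subset_trans Wj (@oI_r _ V (U j)))).
  rewrite !(der_res_comp _ _ (subset_trans Yi (S l i))).
  rewrite !(der_res_comp _ _ (subset_trans Yj (S l j))).
  rewrite -(der_res_comp (S l i) Yi) -(der_res_comp (S l j) Yj) !DE.
  rewrite (ores_comp _ _ (subset_trans YW Wij)).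
  exact: tw_actE.
pose D k := sval (cid (glue k)).
have [DE Duniq] : (forall k i, der_res (S i k) (D k) = twfun (s i) k) /\
    (forall k E, (forall i, der_res (S i k) E = twfun (s i) k) -> D k = E).
  by split=> k; have [] := svalP (cid (glue k)).
exists (TwSec (act D DE)); split=> [i|g gE]; apply: twsec_ext => k /=.
  exact: DE.
apply: Duniq => i.
exact: (congr1 (fun h : twsec a (Z i) => twfun h k) (gE i)).
Qed.

Section Extend.
Variables (V : openset X) (k : cidx U) (HV : V `<=` U k) (D : der V).

(* The section of the twist whose component at the index [k] is [D]. *)
Program Definition tw_extend : twsec a V :=
  @TwSec R X U a V (fun i =>
    ores (oI_sub (@oI_r _ V (U i)) (subset_trans (@oI_l _ V (U i)) HV))
      (uval (a i k)) *: der_res (@oI_l _ V (U i)) D) _.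
Next Obligation.
move=> i j W Wi Wj Wij; apply/unit_actP => /=.
have WV : W `<=` V := subset_trans Wi (@oI_l _ V (U i)).
have Wik : W `<=` oI (U i) (U k).
  exact: oI_sub (subset_trans Wi (@oI_r _ V (U i))) (subset_trans WV HV).
have Wjk : W `<=` oI (U j) (U k).
  exact: oI_sub (subset_trans Wj (@oI_r _ V (U j))) (subset_trans WV HV).
rewrite !der_resZ !(der_res_comp _ _ WV).
rewrite (ores_comp _ _ Wik) (ores_comp _ _ Wjk).
(* What remains is the cocycle identity a_ij a_jk = a_ik on W. *)
rewrite scalerA; congr (_ *: _).
exact: esym (congr1 (@uval R X W) (uco_mul a Wij Wjk Wik)).
Qed.

End Extend.

(** The cocycle identity with three equal indices makes a_kk idempotent in a group. Hence
    [tw_extend] really has the given derivation as its component at k. *)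
Lemma uco1 k (W : openset X) (H : W `<=` oI (U k) (U k)) :
  ores H (uval (a k k)) = 1.
Proof.
have E := uco_mul a H H H.
have : unit_res H (a k k) = 1%g.
  by apply: (mulgI (unit_res H (a k k))); rewrite E mulg1.
by move=> /(congr1 (@uval R X W)).
Qed.

Lemma tw_extendE (V W : openset X) (k i : cidx U) (HV : V `<=` U k) (D : der V)
    (H : W `<=` oI V (U i)) (HW : W `<=` V) (Hik : W `<=` oI (U i) (U k)) :
  der_res H (tw_extend HV D i) = ores Hik (uval (a i k)) *: der_res HW D.
Proof. by rewrite /= der_resZ (der_res_comp _ _ HW) (ores_comp _ _ Hik). Qed.

End TwistSheaf.

(** * Isomorphisms recognized locally *)

Section LocalIso.
Variables (R : realType) (X : fspace R) (F G : omodule X).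

(* The local preimages of a section agree on overlaps by injectivity, so they *)
(* glue.                                                                      *)
Lemma omod_iso_local (phi : omod_hom F G) : is_sheaf F ->
  (forall (V : openset X) (I : Type) (Z : I -> openset X)
     (HZ : forall i, Z i `<=` V), (forall x, V x -> exists i, Z i x) ->
     forall s t : G V, (forall i, mres (HZ i) s = mres (HZ i) t) -> s = t) ->
  (forall V, injective (phi V)) ->
  (forall (V : openset X) (s : G V) x, V x ->
     exists (Z : openset X) (HZ : Z `<=` V), Z x /\
       exists t : F Z, phi Z t = mres HZ s) ->
  omod_iso phi.
Proof.
move=> shF sepG inj surj V.
suff surjV s : exists t, phi V t = s.
  exists (fun s => sval (cid (surjV s))) => s.
    by apply: inj; exact: svalP (cid (surjV _)).
  exact: svalP (cid (surjV s)).
pose loc (x : pts V) := cid (surj V s (sval x) (proj2_sig x)).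
pose Z x := sval (loc x).
have locP x := cid (svalP (loc x)).
pose HZ x : Z x `<=` V := sval (locP x).
have locP' x := svalP (locP x).
have Zx x : Z x (sval x) := (locP' x).1.
pose t x : F (Z x) := sval (cid (locP' x).2).
have tE x : phi _ (t x) = mres (HZ x) s := svalP (cid (locP' x).2).
have cov x : V x -> exists y, Z y x.
  by move=> Vx; exists (exist _ x Vx); exact: (Zx (exist _ x Vx)).
have [|t' [t'E _]] := shF V (pts V) Z HZ cov t.
  move=> x y W Wx Wy; apply: inj; rewrite !hmap_res !tE.
  by rewrite !(mres_comp _ _ (subset_trans Wx (HZ x))).
exists t'; apply: (sepG V (pts V) Z HZ cov) => x.
by rewrite -hmap_res t'E tE.
Qed.

End LocalIso.

Lemma sheafify_sep (R : realType) (X : fspace R) (F : omodule X)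
    (V : openset X) (I : Type) (Z : I -> openset X)
    (HZ : forall i, Z i `<=` V) (covV : forall x, V x -> exists i, Z i x)
    (s t : sheafify F V) :
  (forall i, mres (HZ i) s = mres (HZ i) t) -> s = t.
Proof.
move=> st; apply: shsec_ext => -[x Vx].
have [i Zix] := covV x Vx.
have := congr1 (fun u : shsec F (Z i) => shfun u (exist _ x Zix)) (st i).
move=> E; rewrite (shfun_irr s Vx (HZ i x Zix)).
by rewrite (shfun_irr t Vx (HZ i x Zix)).
Qed.

(** * The isomorphism from the twisted sheaf to T_X (x) L *)

Section TwistTensor.
Variables (R : realType) (X : fspace R) (L : omodule X).
Variables (U : ocover X) (a : ucocycle U).

(* Rescaling the given frames by the cochain comparing the cocycle of [L] to  *)
(* [a] makes [a] itself the transition cocycle.                               *)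
Lemma adapted_frames : represents_class L a ->
  exists (W : ocover X) (t : cidx W -> cidx U)
    (Ht : forall k, W k `<=` U (t k)) (e : forall k, L (W k)),
    (forall k, frame (e k)) /\
    forall k l (Z : openset X) (Zk : Z `<=` W k) (Zl : Z `<=` W l)
      (Zkl : Z `<=` oI (U (t k)) (U (t l))),
      mres Zl (e l) = ores Zkl (uval (a (t k) (t l))) *: mres Zk (e k).
Proof.
move=> [V [e [b [fr eE [W [s [t [Hs [Ht [u uE]]]]]]]]]].
exists W, t, Ht, (fun k => uval (u k) *: mres (Hs k) (e (s k))); split.
  move=> k Z HZ; pose v := unit_res HZ (u k).
  have -> : (fun f : O Z => f *: mres HZ (uval (u k) *: mres (Hs k) (e (s k))))
      = (fun f => f *: mres (subset_trans HZ (Hs k)) (e (s k))) \o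
        (fun f => f * uval v).
    apply: funext => f /=.
    by rewrite mresZ scalerA (mres_comp _ _ (subset_trans HZ (Hs k))).
  apply: bij_comp; first exact: fr.
  exists (fun f => f * uinv v) => f.
    by rewrite -mulrA uvalV mulr1.
  by rewrite -mulrA (mulrC (uinv v)) uvalV mulr1.
move=> k l Z Zk Zl Zkl.
have Zb : Z `<=` oI (V (s k)) (V (s l)).
  exact: oI_sub (subset_trans Zk (@Hs k)) (subset_trans Zl (@Hs l)).
have Zsk : Z `<=` V (s k) := subset_trans Zk (@Hs k).
have Zsl : Z `<=` V (s l) := subset_trans Zl (@Hs l).
have {}eE := congr1 (mres Zb) (eE (s k) (s l)).
have Zw : Z `<=` oI (W k) (W l) := oI_sub Zk Zl.
have {}uE := congr1 (fun v => ores Zw (uval v)) (uE k l).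
move: eE uE; rewrite mresZ (mres_comp _ _ Zsk) (mres_comp _ _ Zsl) => eE.
rewrite /= !oresM !(ores_comp _ _ Zb) !(ores_comp _ _ Zkl).
rewrite !(ores_comp _ _ Zk) !(ores_comp _ _ Zl) => uE.
(* With b_kl u_l = u_k a_kl, the rescaled frames satisfy u_l e_l = u_l b_kl e_k = a_kl (u_k e_k). *)
rewrite !mresZ !(mres_comp _ _ Zsk) !(mres_comp _ _ Zsl) eE !scalerA.
by congr (_ *: _); rewrite mulrC uE mulrC.
Qed.

Variables (W : ocover X) (t : cidx W -> cidx U).
Variables (Ht : forall k, W k `<=` U (t k)) (e : forall k, L (W k)).
Hypothesis e_frame : forall k, frame (e k).
Hypothesis eE : forall k l (Z : openset X) (Zk : Z `<=` W k) (Zl : Z `<=` W l)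
  (Zkl : Z `<=` oI (U (t k)) (U (t l))),
  mres Zl (e l) = ores Zkl (uval (a (t k) (t l))) *: mres Zk (e k).

Let T := tangent X.

Definition twist_pure (V : openset X) (g : twsec a V) (k : cidx W)
    (Z : openset X)
    (HV : Z `<=` V) (Hk : Z `<=` W k) : ptensor T L Z :=
  tpure (der_res (oI_sub HV (subset_trans Hk (@Ht k))) (g (t k)) : T Z)
    (mres Hk (e k)).

Lemma twist_pure_res V (g : twsec a V) k (Z Z' : openset X) (HV : Z `<=` V)
    (Hk : Z `<=` W k) (HV' : Z' `<=` V) (Hk' : Z' `<=` W k) (H : Z' `<=` Z) :
  mres H (twist_pure g HV Hk) = twist_pure g HV' Hk'.
Proof.
rewrite tpure_res /twist_pure (mres_comp _ _ Hk').
by rewrite [mres H _](der_res_comp _ _ (oI_sub HV' (subset_trans Hk' (@Ht k)))).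
Qed.

(** The unit a_kl in e_l = a_kl e_k crosses the tensor sign and turns the component of index l into
    that of index k. *)
Lemma twist_pure_indep V (g : twsec a V) k l (Z : openset X) (HV : Z `<=` V)
    (Hk : Z `<=` W k) (Hl : Z `<=` W l) :
  twist_pure g HV Hk = twist_pure g HV Hl.
Proof.
have Hkl : Z `<=` oI (U (t k)) (U (t l)).
  exact: oI_sub (subset_trans Hk (@Ht k)) (subset_trans Hl (@Ht l)).
rewrite /twist_pure (eE Hk Hl Hkl) tpureZr -tpureZl.
by rewrite (tw_actE g _ (oI_sub HV (subset_trans Hl (@Ht l))) Hkl).
Qed.

(** A section of the sheafified tensor product is a family of germs, so the index k may be chosen
    separately at each point; [twist_germE] shows that the choice does not matter. *)
Definition twist_germ V (g : twsec a V) (x : pts V) :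
    stalk (ptensor T L) (sval x) :=
  let k := cid (cset_cover W (sval x)) in
  germ (conj (proj2_sig x) (svalP k) : oI V (W (sval k)) (sval x))
    (twist_pure g (@oI_l _ V (W (sval k))) (@oI_r _ V (W (sval k)))).

Lemma twist_germE V (g : twsec a V) k (Z : openset X) (HV : Z `<=` V)
    (Hk : Z `<=` W k) (x : pts V) (Zx : Z (sval x)) :
  twist_germ g x = germ Zx (twist_pure g HV Hk).
Proof.
rewrite /twist_germ; case: cid => l Wlx /=.
pose Y := oI Z (W l).
have Yx : Y (sval x) by [].
have YZ : Y `<=` Z := @oI_l _ Z (W l); have Yl : Y `<=` W l := @oI_r _ Z (W l).
rewrite -(germ_mres YZ Zx Yx).
rewrite -[LHS](germ_mres (oI_sub (subset_trans YZ HV) Yl) _ Yx).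
rewrite !(twist_pure_res _ _ _ (subset_trans YZ HV) Yl).
rewrite (twist_pure_res _ _ _ (subset_trans YZ HV) (subset_trans YZ Hk)).
by rewrite (twist_pure_indep g _ Yl (subset_trans YZ Hk)).
Qed.

Program Definition twist_shsec V (g : twist a V) : tensor T L V :=
  @ShSec R X (ptensor T L) V (twist_germ g) _.
Next Obligation.
move=> V g x; have [k Wkx] := cset_cover W (sval x).
exists (oI V (W k)), (@oI_l _ V (W k)).
exists (twist_pure g (@oI_l _ V (W k)) (@oI_r _ V (W k))); split.
  by split; first exact: proj2_sig.
by move=> y; exact: twist_germE.
Qed.

Lemma twist_shsec_linear V : linear (@twist_shsec V).
Proof.
move=> f g h; apply: shsec_ext => x /=.
have [k Wkx] := cset_cover W (sval x).
pose Z := oI V (W k); have ZV : Z `<=` V := @oI_l _ V (W k).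
have Zk : Z `<=` W k := @oI_r _ V (W k).
have Zx : Z (sval x) by split; first exact: proj2_sig.
rewrite !(twist_germE _ ZV Zk Zx) (germZ (proj2_sig x) ZV) [RHS]germD.
congr germ; rewrite /twist_pure -tpureZl -tpureDl; congr tpure.
rewrite [LHS]der_resD [X in X + _ = _]der_resZ.
by rewrite (ores_comp _ _ ZV).
Qed.

HB.instance Definition _ V :=
  GRing.isLinear.Build (O V) (twist a V) (tensor T L V) _ (@twist_shsec V)
    (@twist_shsec_linear V).

Program Definition twist_to_tensor : omod_hom (twist a) (tensor T L) :=
  @OModHom R X _ _ (fun V => @twist_shsec V) _.
Next Obligation.
move=> V V' H g; apply: shsec_ext => x /=.
have [k Wkx] := cset_cover W (sval x).
pose Z := oI V' (W k); have ZV : Z `<=` V' := @oI_l _ V' (W k).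
have Zk : Z `<=` W k := @oI_r _ V' (W k).
have Zx : Z (sval x) by split; first exact: proj2_sig.
rewrite (twist_germE _ ZV Zk Zx).
rewrite (twist_germE (x := Defs.incl H x) g (subset_trans ZV H) Zk Zx).
congr germ; rewrite /twist_pure; congr tpure.
pose Zt := subset_trans Zk (@Ht k).
exact: (der_res_comp _ _ (oI_sub (subset_trans ZV H) Zt)).
Qed.

(** Equal germs come from equal pure tensors on a smaller open; cancelling the frame gives equal
    components at [t k], and the transition relation carries the equality to any index i. *)
Lemma twist_to_tensor_inj V : injective (twist_to_tensor V).
Proof.
move=> g h gh; apply: twsec_ext => i.
have loc (x : pts (oI V (U i))) : exists (Z : openset X)
    (HZ : Z `<=` oI V (U i)),
    Z (sval x) /\ der_res HZ (twfun g i) = der_res HZ (twfun h i).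
  case: x => x [Vx Uix] /=; have [k Wkx] := cset_cover W x.
  have := congr1 (fun s : shsec _ V => shfun s (exist _ x Vx)) gh => /=.
  pose Y := oI V (W k); have YV : Y `<=` V := @oI_l _ V (W k).
  have Yk : Y `<=` W k := @oI_r _ V (W k).
  have Yx : Y x by [].
  rewrite !(twist_germE (x := exist _ x Vx) _ YV Yk Yx).
  move=> /germP[Z [/= Zg [Zh [Zx E]]]].
  have ZV := subset_trans Zg YV; have Zk := subset_trans Zg Yk.
  have {}E : twist_pure g ZV Zk = twist_pure h ZV Zk.
    rewrite -(twist_pure_res g YV Yk ZV Zk Zg).
    rewrite -(twist_pure_res h YV Yk ZV Zk Zh).
    exact: E.
  have {}E := tpure_inj (e_frame Zk) E.
  pose S := oI Z (U i); have SZ : S `<=` Z := @oI_l _ Z (U i).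
  have Si : S `<=` oI V (U i) := oI_sub (subset_trans SZ ZV) (@oI_r _ Z (U i)).
  exists S, Si; split; first by split.
  have St : S `<=` oI V (U (t k)).
    exact: subset_trans SZ (oI_sub ZV (subset_trans Zk (@Ht k))).
  have Sit : S `<=` oI (U i) (U (t k)).
    exact: oI_sub (@oI_r _ Z (U i)) (subset_trans St (@oI_r _ V (U (t k)))).
  rewrite !(tw_actE _ Si St Sit); congr (_ *: _).
  have := congr1 (der_res SZ) E.
  by rewrite !(der_res_comp _ _ St).
pose Z x := sval (cid (loc x)).
have locP x := cid (svalP (cid (loc x))).
apply: (@der_sep _ _ _ _ Z (fun x => sval (locP x))).
  move=> x Vx; exists (exist _ x Vx).
  exact: (svalP (locP (exist _ x Vx))).1.
by move=> x; exact: (svalP (locP x)).2.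
Qed.

(** Near x the section comes from the presheaf tensor product, where the frame reduces it to one
    tensor D (x) e_k; D then extends to a twisted section. *)
Lemma twist_to_tensor_surj V (s : tensor T L V) x : V x ->
  exists (Z : openset X) (HZ : Z `<=` V), Z x /\
    exists g : twist a Z, twist_to_tensor Z g = mres HZ s.
Proof.
move=> Vx; have [k Wkx] := cset_cover W x.
have [Y [YV [tau [Yx tauE]]]] := shloc s (exist _ x Vx).
pose Z := oI Y (W k); have ZY : Z `<=` Y := @oI_l _ Y (W k).
have Zk : Z `<=` W k := @oI_r _ Y (W k).
exists Z, (subset_trans ZY YV); split; first by split.
have [D DE] := tpure_surj (e_frame Zk) (mres ZY tau).
exists (tw_extend a (subset_trans Zk (@Ht k)) D); apply: shsec_ext => y /=.
have Zy := proj2_sig y; have Yy := ZY _ Zy.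
rewrite (twist_germE _ (@subset_refl _ Z) Zk Zy).
have -> : shfun s (Defs.incl (subset_trans ZY YV) y) = germ Yy tau.
  by rewrite -(tauE (exist _ _ Yy)); exact: shfun_irr.
rewrite -(germ_mres ZY Yy Zy) DE; congr germ; congr tpure.
have Hkk : Z `<=` oI (U (t k)) (U (t k)).
  exact: oI_sub (subset_trans Zk (@Ht k)) (subset_trans Zk (@Ht k)).
by rewrite (tw_extendE _ _ _ _ (@subset_refl _ Z) Hkk) uco1 scale1r der_res_id.
Qed.

Lemma twist_to_tensor_iso : omod_iso twist_to_tensor.
Proof.
apply: omod_iso_local; first exact: twist_sheaf.
- exact: sheafify_sep.
- exact: twist_to_tensor_inj.
- exact: twist_to_tensor_surj.
Qed.

End TwistTensor.

Lemma twist_iso_tensor (R : realType) (X : fspace R) (L : omodule X)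
    (U : ocover X) (a : ucocycle U) : represents_class L a ->
  exists Phi : omod_hom (twist a) (tensor (tangent X) L), omod_iso Phi.
Proof.
move=> /adapted_frames[W [t [Ht [e [fr eE]]]]].
by exists (twist_to_tensor Ht eE); exact: twist_to_tensor_iso.
Qed.

Local Notation iota := Defs.iota.

(** * Scalars, induced maps and refinements on H^1 *)

Section CechClasses.
Variables (R : realType) (X : fspace R).
Implicit Types F G : omodule X.

Lemma h1_reprK F (A : H1 F) : h1_class (h1_repr A) = A.
Proof.
case: A => P PE; apply: eq_exist.
by rewrite /h1_repr; case: cid => -[V c] /= ->.
Qed.

Lemma h1_repr_class F (V : ocover X) (c : cocycle_on F V) :
  cohomologous (h1_repr (h1_class c)) (Cocycle c).
Proof.
have /h1P := h1_reprK (h1_class c).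
by case: (h1_repr _).
Qed.

Lemma cohomologousZ F (z : R[i]) (c d : cocycle F) : cohomologous c d ->
  cohomologous (Cocycle (cocycleZ z c)) (Cocycle (cocycleZ z d)).
Proof.
move=> [W [s [t [Hs [Ht [b E]]]]]].
exists W, s, t, Hs, Ht, (fun k => ocst _ z *: b k) => k l /=.
by rewrite !mresZ !ores_cst -!scalerBr E.
Qed.

Lemma h1Z_class F (z : R[i]) (V : ocover X) (c : cocycle_on F V) :
  h1Z z (h1_class c) = h1_class (cocycleZ z c).
Proof. by apply/h1P; apply: cohomologousZ (h1_repr_class c). Qed.

Section Map.
Variables (F G : omodule X) (phi : omod_hom F G).

Lemma cohomologous_map (c d : cocycle F) : cohomologous c d ->
  cohomologous (Cocycle (cocycle_map phi c)) (Cocycle (cocycle_map phi d)).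
Proof.
move=> [W [s [t [Hs [Ht [b E]]]]]].
exists W, s, t, Hs, Ht, (fun k => phi _ (b k)) => k l /=.
by rewrite -!hmap_res -!linearB E.
Qed.

Lemma h1_map_class (V : ocover X) (c : cocycle_on F V) :
  h1_map phi (h1_class c) = h1_class (cocycle_map phi c).
Proof. by apply/h1P; apply: cohomologous_map (h1_repr_class c). Qed.

Lemma h1_mapZ (z : R[i]) (A : H1 F) :
  h1_map phi (h1Z z A) = h1Z z (h1_map phi A).
Proof.
rewrite /h1Z h1_map_class -/(h1Z z (h1_map phi A)) /h1_map h1Z_class.
apply/h1P; exists (coc_cover (h1_repr A)), id, id.
exists (fun k => @subset_refl _ _), (fun k => @subset_refl _ _), (fun=> 0).
by move=> k l /=; rewrite linearZ subrr !mres0 subrr.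
Qed.

(** A cochain bounding the difference of the images lifts through [phi] term by term, and
    injectivity on overlaps lifts the coboundary equation. *)
Lemma h1_map_inj : omod_iso phi -> injective (h1_map phi).
Proof.
move=> iso A B /h1P[W [s [t [Hs [Ht [b E]]]]]].
rewrite -(h1_reprK A) -(h1_reprK B); apply/h1P.
have surj k : exists c, phi _ c = b k.
  by have [g _ gK] := iso (W k); exists (g (b k)).
exists W, s, t, Hs, Ht, (fun k => sval (cid (surj k))) => k l.
apply: (bij_inj (iso (oI (W k) (W l)))).
by rewrite !linearB !hmap_res !(svalP (cid (surj _))) -E.
Qed.

End Map.

Section Refine.
Variables (F : omodule X) (V W : ocover X) (s : cidx W -> cidx V).
Variables (Hs : forall k, W k `<=` V (s k)) (c : cocycle_on F V).

Program Definition cocycle_refine : cocycle_on F W :=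
  @CocycleOn R X F W (fun k l => mres (oIS (@Hs k) (@Hs l)) (c (s k) (s l))) _.
Next Obligation.
move=> i j k Z Zij Zjk Zik /=.
rewrite (mres_comp _ _ (subset_trans Zij (oIS (@Hs i) (@Hs j)))).
rewrite (mres_comp _ _ (subset_trans Zjk (oIS (@Hs j) (@Hs k)))).
rewrite (mres_comp _ _ (subset_trans Zik (oIS (@Hs i) (@Hs k)))).
exact: coc_add.
Qed.

(** Needed because [H0_act] only accepts cocycles on covers refining the one that carries [a]. *)
Lemma h1_class_refine : h1_class cocycle_refine = h1_class c.
Proof.
apply/h1P; exists W, id, s, (fun k => @subset_refl _ _), Hs, (fun=> 0).
move=> k l /=.
by rewrite mres_id subrr !mres0 subrr.
Qed.

End Refine.
End CechClasses.

(** * Derivation part and diagonal part in [G2] *)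

Section G2Structure.
Variables (R : realType) (X : fspace R) (U : openset X).

Lemma iota_inj : injective (@Defs.iota R X U).
Proof.
move=> D E DE; apply: der_ext => V H f.
have := congr1 (fun g : G2 U => (gfun g H (f, 0)).2) DE.
by rewrite /= !addr0.
Qed.

Lemma iotaD (D E : der U) : iota (D + E) = (iota D * iota E)%g.
Proof. by apply: G2_ext => V H p /=; rewrite addrA. Qed.

Lemma iotaN (D : der U) : iota (- D) = (iota D)^-1%g.
Proof. by apply: G2_ext => V H p /=; rewrite addrC. Qed.

Lemma diag_iota (u : ounit U) (D : der U) :
  (diag u * iota D = iota (uval u *: D) * diag u)%g.
Proof. by apply: G2_ext => V H p /=; rewrite mulrDr. Qed.

Lemma diagC (u v : ounit U) : (diag u * diag v = diag v * diag u)%g.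
Proof. by apply: G2_ext => V H p /=; rewrite mulrCA. Qed.

Lemma xi2_iota_diag (D : der U) (u : ounit U) : xi2 (iota D * diag u)%g = u.
Proof.
(* The function part of t is 0, which D kills because 0 is a constant. *)
have ocst0 : ocst U 0 = 0 by exact: val_inj.
have := dfun_cst D (@subset_refl _ U) 0; rewrite ocst0 => dfun0.
apply: ounit_ext; rewrite /= ores_id mulr1.
by rewrite [X in X + _]dfun0 add0r.
Qed.

(** As g fixes functions modulo t, its multiplicativity on functions is the Leibniz rule for the
    coefficient of t. This derivation and the image of t determine g ([gfunE]). *)
Lemma G2_decomp (g : G2 U) : exists D, g = (iota D * diag (xi2 g))%g.
Proof.
have gD (V : openset X) (H : V `<=` U) :
    {morph (fun f : O V => (gfun g H (f, 0)).2) : x y / x + y}.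
  move=> x y.
  have -> : (x + y, 0) = ((x, 0) : dual (O V)) + ((y, 0) : dual (O V)).
    by rewrite [RHS]/GRing.add /= /add_pair /= addr0.
  by rewrite gfunD.
have gM (V : openset X) (H : V `<=` U) (x y : O V) :
    (gfun g H (x * y, 0)).2 = x * (gfun g H (y, 0)).2 + y * (gfun g H (x, 0)).2.
  have -> : (x * y, 0) = ((x, 0) : dual (O V)) * (y, 0).
    by rewrite [RHS]/GRing.mul /= /dual_mul /= mulr0 mul0r addr0.
  by rewrite gfunM /= !gfun_mod /= [_ * y]mulrC.
have gC (V : openset X) (H : V `<=` U) (c : R[i]) :
    (gfun g H (ocst V c, 0)).2 = 0 by rewrite gfun_cst.
have gR (V W : openset X) (HV : V `<=` U) (HW : W `<=` U) (HWV : W `<=` V)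
    (f : O V) :
    ores HWV (gfun g HV (f, 0)).2 = (gfun g HW (ores HWV f, 0)).2.
  have := congr1 snd (gfun_res g HV HW HWV (f, 0)).
  by rewrite /dual_res /= ores0.
exists (Der gD gM gC gR); apply: G2_ext => V H p.
by rewrite [LHS]gfunE.
Qed.

(* The product is a section of ker(xi_2) because the two diagonal parts       *)
(* cancel; what remains is additive in the three derivations.                 *)
Lemma twisted_conj (u v : ounit U) (D E G : der U) :
  (iota D * diag u * iota G * diag v * (iota E * diag u)^-1 * (diag v)^-1)%g =
  iota (D + uval u *: G - uval v *: E).
Proof.
(* Inserting [diag v] and its inverse lets [diag_iota] be used backwards to remove the factor v in
   front of E. *)
rewrite !iotaD -scalerN -(mulgK (diag v) (iota (uval v *: - E))).
rewrite -diag_iota iotaN.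
rewrite -(mulgA (iota D) (diag u)) diag_iota !mulgA; congr (_ * _)%g.
rewrite -(mulgA _ (diag u)) diagC !mulgA invgM mulgA.
by rewrite mulgK.
Qed.

End G2Structure.

Section G2Restriction.
Variables (R : realType) (X : fspace R) (U V : openset X) (H : V `<=` U).

Lemma unit_res_comp (W : openset X) (HWV : W `<=` V) (HWU : W `<=` U)
    (u : ounit U) :
  unit_res HWV (unit_res H u) = unit_res HWU u.
Proof. by apply: ounit_ext; exact: ores_comp. Qed.

Lemma G2_res_iota_diag (D : der U) (u : ounit U) :
  G2_res H (iota D * diag u)%g = (iota (der_res H D) * diag (unit_res H u))%g.
Proof.
apply: G2_ext => W HW p /=.
by rewrite (ores_comp H HW (subset_trans HW H)).
Qed.

End G2Restriction.

(** * Reading twisted sections through one component *)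

Section TwistComponents.
Variables (R : realType) (X : fspace R) (U : ocover X) (a : ucocycle U).
Variables (i : cidx U) (V : openset X) (HV : V `<=` U i).

(** Over an open inside U_i the component at i determines the one at j as its multiple by a_ji.
    Equations between twisted sections thus reduce to equations between derivations. *)
Lemma tw_comp_inj : injective (@tw_comp R X U a i V HV).
Proof.
move=> g h gh; apply: twsec_ext => j.
pose Y := oI V (U j); have YV : Y `<=` V := @oI_l _ V (U j).
have Yj : Y `<=` U j := @oI_r _ V (U j).
have Yi : Y `<=` oI V (U i) := oI_sub YV (subset_trans YV HV).
have Yji : Y `<=` oI (U j) (U i) := oI_sub Yj (subset_trans YV HV).
have gE (f : twsec a V) :
    twfun f j = ores Yji (uval (a j i)) *: der_res YV (tw_comp HV f).
  rewrite -[LHS](der_res_id (@subset_refl _ Y)) (tw_actE f _ Yi Yji).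
  by rewrite /tw_comp (der_res_comp _ _ Yi).
by rewrite (gE g) (gE h) gh.
Qed.

Lemma tw_compB (g h : twist a V) : tw_comp HV (g - h) =
  tw_comp HV g - tw_comp HV h.
Proof. exact: der_resB. Qed.

Lemma tw_compZ (f : O V) (g : twist a V) : tw_comp HV (f *: g) =
  f *: tw_comp HV g.
Proof.
rewrite /tw_comp [LHS]der_resZ.
by rewrite (ores_comp _ _ (@subset_refl _ V)) ores_id.
Qed.

(** The change of index from k to i produces the factor in a_kl D_l, which is what makes D_k - a_kl
    D_l a coboundary. *)
Lemma tw_comp_extend (W : openset X) (k : cidx U) (HW : W `<=` U k) (D : der W)
    (H : V `<=` W) (Hik : V `<=` oI (U i) (U k)) :
  tw_comp HV (mres (o := twist a) H (tw_extend a HW D)) =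
  ores Hik (uval (a i k)) *: der_res H D.
Proof.
have HVi : V `<=` oI W (U i) := oI_sub H HV.
rewrite /tw_comp [LHS](der_res_comp _ _ HVi).
exact: tw_extendE.
Qed.

End TwistComponents.

(** * The action of constants on H^1 *)

Lemma H0_act_h1Z (R : realType) (X : fspace R) (U : ocover X) (a : ucocycle U)
    (h : ounit (@oT X)) (z : R[i]) (gamma gamma' : H1 (twist a)) :
  uval h = ocst oT z -> H0_act h gamma gamma' <-> gamma' = h1Z z gamma.
Proof.
move=> hz.
have hzV (V : openset X) (H : V `<=` oT) : uval (unit_res H h) = ocst V z.
  by rewrite /= hz ores_cst.
split.
  move=> [V [s [Hs [hl [c [c' [xh -> -> E]]]]]]].
  rewrite h1Z_class; apply/h1P.
  pose D k := sval (cid (G2_decomp (hl k))).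
  have hlE k : hl k = (iota (D k) * diag (unit_res (@oT_sub _ (V k)) h))%g.
    by rewrite -xh; exact: svalP (cid (G2_decomp (hl k))).
  exists V, id, id, (fun k => @subset_refl _ _), (fun k => @subset_refl _ _).
  (* The bounding cochain consists of the derivation parts of the lifts. *)
  exists (fun k => tw_extend a (Hs k) (D k)) => k l.
  rewrite !(mres_id (o := twist a)).
  pose Hkl := subset_trans (@oI_l _ (V k) (V l)) (Hs k).
  apply: (@tw_comp_inj _ _ _ a _ _ Hkl).
  rewrite !tw_compB tw_compZ.
  have Hkk : oI (V k) (V l) `<=` oI (U (s k)) (U (s k)) := oI_sub Hkl Hkl.
  rewrite (tw_comp_extend _ _ _ _ _ Hkk) uco1 scale1r.
  rewrite (tw_comp_extend _ _ _ _ _ (oIS (Hs k) (Hs l))).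
  have := E k l; rewrite /= -/Hkl !hlE !G2_res_iota_diag.
  rewrite !(unit_res_comp _ _ (@oT_sub _ (oI (V k) (V l)))) twisted_conj hzV.
  move=> /iota_inj ->.
  by rewrite /= addrAC addrK.
(* Conversely, a representative of gamma is refined to a cover subordinate to U; lifts with zero
   derivation part multiply it by z on the nose. *)
move=> ->; pose r := h1_repr gamma; pose V0 := coc_cover r.
have covV x : exists p : cidx V0 * cidx U, oI (V0 p.1) (U p.2) x.
  have [k Vx] := cset_cover V0 x; have [i Ux] := cset_cover U x.
  by exists (k, i).
pose V := OCover covV.
pose c := cocycle_refine (W := V) (s := fun p => p.1)
  (fun p => @oI_l _ (V0 p.1) (U p.2)) r.
have cE : gamma = h1_class c by rewrite h1_class_refine h1_reprK.
exists V, (fun p => p.2), (fun p => @oI_r _ (V0 p.1) (U p.2)).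
exists (fun p => iota 0 * diag (unit_res (@oT_sub _ (V p)) h))%g.
exists c, (cocycleZ z c); split=> //.
- by move=> k; exact: xi2_iota_diag.
- by rewrite cE h1Z_class.
move=> k l /=; rewrite !G2_res_iota_diag.
rewrite !(unit_res_comp _ _ (@oT_sub _ (oI (V k) (V l)))) twisted_conj.
rewrite hzV tw_compZ.
have der_res0 (Y Z : openset X) (HZ : Z `<=` Y) : der_res HZ 0 = 0.
  exact: (@mres0 R X (tangent X)).
by rewrite !der_res0 add0r scaler0 subr0.
Qed.

Theorem lemma4p3p1 (R : realType) (X : fspace R)
    (X_variety : smooth_connected_variety X)
    (X_units : forall u : ounit (X := X) oT,
       exists2 c : R[i], c != 0 & uval u = ocst oT c)
    (L : omodule X) (L_line_bundle : line_bundle L)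
    (U : ocover X) (a : ucocycle U) (a_class : represents_class L a) :
  (exists Phi : omod_hom (twist a) (tensor (tangent X) L), omod_iso Phi) /\
  (forall h : ounit (X := X) oT,
     exists c : R[i], [/\ c != 0, uval h = ocst oT c,
       (forall gamma gamma' : H1 (twist a),
          H0_act h gamma gamma' <-> gamma' = h1Z c gamma) &
       (forall Phi : omod_hom (twist a) (tensor (tangent X) L), omod_iso Phi ->
          forall gamma gamma' : H1 (twist a),
            H0_act h gamma gamma' <->
            h1_map Phi gamma' = h1Z c (h1_map Phi gamma))]).
Proof.
split; first exact: twist_iso_tensor.
move=> h; have [c c0 hc] := X_units h; exists c; split=> //.
  by move=> gamma gamma'; exact: H0_act_h1Z.
(* Multiplication by c passes through the injective map induced by [Phi]. *)
move=> Phi iso gamma gamma'; rewrite (H0_act_h1Z _ _ hc) -h1_mapZ.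
by split=> [->//|/(h1_map_inj iso)].
Qed.
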